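(* If $\nu = \frac12[\delta_{-1}+\delta_{1}]$ is the symmetric Bernoulli distribution, then $$G_{\lambda,\mu}(z) = [G_\nu(z)]^{\lambda}$$ for every $\lambda\geq 1$, where $$\mu(dx) = \mu_\lambda(dx) = \frac{1}{2^{\lambda}}\left[[\delta_1+\delta_{-1}](dx) + \frac{1}{\sqrt{|x|}}\,h(\sqrt{|x|})\,dx\right]$$ and $$h(x) = h_\lambda(x) := \frac{\lambda(\lambda-1)}{4}\,x^{\lambda-1}\, {}_2F_1\!\left(\frac{\lambda}{2}+1,\ \frac{\lambda+1}{2};\ 2;\ 1-x\right)\mathbf{1}_{[0,1]}(x).$$
   Context: For a real number $\lambda>0$ and a probability measure $\mu$ supported in the real line (possibly depending on $\lambda$), the generalized Stieltjes transform is $G_{\lambda,\mu}(z) := \int \frac{1}{(z-x)^{\lambda}}\,\mu(dx)$, for complex $z$ lying outside the support of $\mu$ and such that $(z-x)^\lambda$ is the principal branch of the power function. $G_\nu := G_{1,\nu}$ is the ordinary Stieltjes transform; for the symmetric Bernoulli distribution above, $G_\nu(z)=\frac{z}{z^2-1}$. $\delta_a$ is the Dirac mass at $a$ and $\mathbf{1}_{[0,1]}$ is the indicator function of $[0,1]$. ${}_2F_1(a,b;c;u)$ is the Gauss hypergeometric function, given for $|u|<1$ by $\sum_{n\ge0}\frac{(a)_n(b)_n}{(c)_n}\frac{u^n}{n!}$ and extended analytically to the complex plane cut along $[1,\infty)$, with $(a)_n = a(a+1)\cdots(a+n-1)$ and $(a)_0=1$.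
   Formalization: The density (1/√|x|) h(√|x|) is replaced by 2|x| h(x²), because with the printed density μ has total mass 3/2 for λ = 2 and the identity fails; h, the atoms and the factor 1/2^λ are unchanged. *)

(* Defs.v *)
From HB Require Import structures.
From mathcomp Require Import all_boot all_order all_algebra.
From mathcomp Require Import all_classical all_reals all_analysis.
From mathcomp Require Import measurable_realfun complex.

Set Implicit Arguments.
Unset Strict Implicit.
Unset Printing Implicit Defensive.

Import Order.TTheory GRing.Theory Num.Theory.
Import numFieldNormedType.Exports.

Local Open Scope classical_set_scope.
Local Open Scope ring_scope.

Section complex_power.
Context {R : realType}.
Implicit Types (z : R[i]) (a : R).

(* The principal argument, with values in ]-pi, pi]; at z = 0 it takes an
   irrelevant value. *)
Definition Carg z : R :=
  let t := acos (complex.Re z / Normc.normc z) in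
  if 0 <= complex.Im z then t else - t.

Definition Cpow z a : R[i] :=
  let r := Normc.normc z `^ a in
  Complex (r * cos (a * Carg z)) (r * sin (a * Carg z)).

(* The complement of ]-oo, 0], which is where the principal branch of the power
   function is holomorphic. *)
Definition slit_plane : set (R[i]) :=
  [set z | ~ (complex.Re z <= 0 /\ complex.Im z = 0)].

End complex_power.

Section stieltjes.
Context {R : realType}.
Implicit Types mu : {measure set (measurableTypeR R) -> \bar R}.

Definition Cintegral mu (f : R -> R[i]) : R[i] :=
  Complex (\int[mu]_x complex.Re (f x)) (\int[mu]_x complex.Im (f x)).

Definition support mu : set R :=
  [set x | forall U : set R, open U -> U x -> mu U != 0%E].

(* z lies outside the support (0 is not in the slit plane) and z - x stays in
   the domain of the principal branch for every x in the support. *)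
Definition stieltjes_domain mu : set (R[i]) :=
  [set z | forall x, support mu x -> slit_plane (z - real_complex R x)].

Definition stieltjes (l : R) mu (z : R[i]) : R[i] :=
  Cintegral mu (fun x => (Cpow (z - real_complex R x) l)^-1).

End stieltjes.

Section density_measure.
Local Open Scope ereal_scope.
Context d (T : measurableType d) (R : realType).
Variables (m : {measure set T -> \bar R}) (f : T -> R).

Definition density_measure (mf : measurable_fun setT f)
    (f0 : forall x, (0 <= f x)%R) : set T -> \bar R :=
  fun A => \int[m]_(x in A) (f x)%:E.

Hypotheses (mf : measurable_fun setT f) (f0 : forall x, (0 <= f x)%R).
Let nu := density_measure mf f0.

Let nu_set0 : nu set0 = 0.
Proof. by rewrite /nu /density_measure integral_set0. Qed.

Let nu_ge0 A : 0 <= nu A.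
Proof. by apply: integral_ge0 => x _; rewrite lee_fin. Qed.

Let nu_sigma_additive : semi_sigma_additive nu.
Proof.
move=> /= F mF tF mUF; rewrite /nu /density_measure; apply: cvg_toP.
  apply: ereal_nondecreasing_is_cvgn => p n pn.
  by apply: lee_sum_nneg_natr => // k _ _; exact: nu_ge0.
rewrite ge0_integral_bigcup//=.
- by apply/measurable_EFinP; exact: measurable_funTS.
- by move=> x _; rewrite lee_fin.
Qed.

HB.instance Definition _ := isMeasure.Build _ _ _
  (density_measure mf f0) nu_set0 nu_ge0 nu_sigma_additive.

End density_measure.

Section hypergeometric.
Context {R : realType}.
Implicit Types a b c u x l : R.

Definition pochhammer a (n : nat) : R := \prod_(i < n) (a + i%:R).

Definition hyp2F1_coef a b c (n : nat) : R :=
  pochhammer a n * pochhammer b n / pochhammer c n / n`!%:R.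

(* The Gauss series, for real -1 < u < 1. No analytic continuation is needed
   below: the function is only used at u = 1 - x with 0 <= x <= 1, and the
   branch point u = 1 corresponds to the Lebesgue-null set x = 0. *)
Definition hyp2F1 a b c u : R :=
  limn (series (fun n => hyp2F1_coef a b c n * u ^+ n)).

Definition hfun l x : R :=
  l * (l - 1) / 4 * x `^ (l - 1) *
  hyp2F1 (l / 2 + 1) ((l + 1) / 2) 2 (1 - x) * \1_`[0, 1] x.

(* The symmetric density on [-1, 1] whose two halves are the images of
   hfun l x dx under x |-> sqrt x and x |-> - sqrt x, whence the factor 2 |x|
   and the argument x ^ 2. The printed formula hfun l (sqrt |x|) / sqrt |x| is
   a change of variables in the wrong direction: with it the measure mu_l below
   has total mass (2 ^ l - 1) / 2 ^ (l - 1), which exceeds 1 for every l > 1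
   (it is 3 / 2 for l = 2), and the identity fails. *)
Definition h_density l x : R := 2 * `|x| * hfun l (x ^+ 2).

Lemma pochhammer_ge0 a n : 0 <= a -> 0 <= pochhammer a n.
Proof. by move=> a0; apply: prodr_ge0 => i _; rewrite addr_ge0. Qed.

Lemma hyp2F1_coef_ge0 a b c n :
  0 <= a -> 0 <= b -> 0 <= c -> 0 <= hyp2F1_coef a b c n.
Proof.
by move=> a0 b0 c0; rewrite /hyp2F1_coef !mulr_ge0 ?invr_ge0 ?pochhammer_ge0.
Qed.

(* A Gauss series with nonnegative terms is the value of the corresponding
   series in \bar R, also when it diverges (limn is then 0, as is fine +oo). *)
Lemma hyp2F1_fine a b c u : 0 <= a -> 0 <= b -> 0 <= c -> 0 <= u ->
  hyp2F1 a b c u =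
  fine (\sum_(0 <= n <oo) (hyp2F1_coef a b c n * u ^+ n)%:E)%E.
Proof.
move=> a0 b0 c0 u0; rewrite /hyp2F1; set v := fun n => _.
have v0 n : 0 <= v n by rewrite mulr_ge0 ?exprn_ge0 ?hyp2F1_coef_ge0.
have E : (fun n => \sum_(0 <= k < n) (v k)%:E)%E = EFin \o series v.
  by apply/funext => n /=; rewrite sumEFin.
have [cv|ncv] := pselect (cvgn (series v)).
  by rewrite [X in fine (limn X)]E EFin_lim.
rewrite dvgP//.
have /cvg_ex[/= s sP] : cvgn (EFin \o series v).
  by rewrite -E; apply: is_cvg_nneseries => n _ _; rewrite lee_fin.
rewrite [X in fine (limn X)]E (cvg_lim _ sP)//.
case: s sP => //= s sP; exfalso; apply: ncv; apply/cvg_ex; exists s.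
by have /fine_cvgP[] := sP.
Qed.

Lemma hyp2F1_ge0 a b c u : 0 <= a -> 0 <= b -> 0 <= c -> 0 <= u ->
  0 <= hyp2F1 a b c u.
Proof.
move=> a0 b0 c0 u0; rewrite hyp2F1_fine// fine_ge0//.
by apply: nneseries_ge0 => n _ _; rewrite lee_fin mulr_ge0 ?exprn_ge0 ?hyp2F1_coef_ge0.
Qed.

Lemma h_ge0 l x : 1 <= l -> 0 <= hfun l x.
Proof.
move=> l1; have l0 : 0 <= l by rewrite (le_trans _ l1).
rewrite /hfun indicE; case: (boolP (x \in _)) => [|_]; last by rewrite mulr0.
rewrite inE/= in_itv/= => /andP[x0 x1]; rewrite mulr1.
by rewrite !mulr_ge0 ?powR_ge0 ?hyp2F1_ge0 ?subr_ge0 ?addr_ge0 ?divr_ge0 ?addr_ge0.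
Qed.

Lemma measurable_h l : 1 <= l -> measurable_fun [set: R] (hfun l).
Proof.
move=> l1; have l0 : 0 <= l by rewrite (le_trans _ l1).
pose a := l / 2 + 1; pose b := (l + 1) / 2.
have a0 : 0 <= a by rewrite addr_ge0 ?divr_ge0.
have b0 : 0 <= b by rewrite divr_ge0 ?addr_ge0.
pose t (n : nat) x := hyp2F1_coef a b 2 n * (1 - x) ^+ n * \1_`[0, 1] x.
have t0 n x : 0 <= t n x.
  rewrite /t indicE; case: (boolP (x \in _)) => [|_]; last by rewrite mulr0.
  rewrite inE/= in_itv/= => /andP[x0 x1]; rewrite mulr1.
  by rewrite mulr_ge0 ?hyp2F1_coef_ge0 ?exprn_ge0 ?subr_ge0.
have m1 : measurable_fun [set: R] (\1_`[0, 1] : R -> R).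
  exact: measurable_indic.
have hE : hfun l = fun x => l * (l - 1) / 4 * x `^ (l - 1) *
    fine (\sum_(0 <= n <oo) (t n x)%:E)%E * \1_`[0, 1] x.
  apply/funext => x; rewrite /hfun indicE.
  case: (boolP (x \in _)) => [x01|_]; last by rewrite !mulr0.
  have := x01; rewrite inE/= in_itv/= => /andP[x0 x1].
  rewrite hyp2F1_fine ?subr_ge0//; do 3 f_equal.
  apply: eq_eseriesr => n _; rewrite /t indicE x01 mulr1.
  by rewrite -/a -/b.
rewrite hE; apply: measurable_funM => //; apply: measurable_funM.
  by apply: measurable_funM => //; exact: measurable_powR.
apply: measurableT_comp => //.
apply: ge0_emeasurable_sum => [k x _ _|k _]; first by rewrite lee_fin.
apply/measurable_EFinP; apply: measurable_funM => //.
apply: measurable_funM => //; apply: measurable_funX.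
exact: measurable_funB.
Qed.

Lemma h_density_ge0 l : 1 <= l -> forall x, 0 <= h_density l x.
Proof. by move=> l1 x; apply: mulr_ge0; [exact: mulr_ge0|exact: h_ge0]. Qed.

Lemma measurable_h_density l : 1 <= l ->
  measurable_fun [set: measurableTypeR R] (h_density l).
Proof.
move=> l1; apply: measurable_funM.
  by apply: measurable_funM => //; exact: measurable_normr.
by apply: measurableT_comp; [exact: measurable_h|exact: measurable_funX].
Qed.

End hypergeometric.

Section measures.
Context {R : realType}.
Local Notation T := (measurableTypeR R).
Local Notation "\delta_ a" := (@dirac _ T (a%R : R) R) (at level 8, a at level 2).

Definition sym_bernoulli : set T -> \bar R :=
  mscale (2^-1)%:nng (measure_add \delta_(-1) \delta_(1)).

HB.instance Definition _ := Measure.on sym_bernoulli.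

Definition h_measure (l : R) (l1 : 1 <= l) : set T -> \bar R :=
  density_measure (@lebesgue_measure R)
    (measurable_h_density l1) (h_density_ge0 l1).

HB.instance Definition _ (l : R) (l1 : 1 <= l) := Measure.on (h_measure l1).

Definition mu_l (l : R) (l1 : 1 <= l) : set T -> \bar R :=
  mscale ((2 `^ l)^-1)%:nng
    (measure_add (measure_add \delta_(1) \delta_(-1)) (h_measure l1)).

HB.instance Definition _ (l : R) (l1 : 1 <= l) := Measure.on (mu_l l1).

Local Open Scope ereal_scope.

Lemma sym_bernoulliE (A : set T) :
  sym_bernoulli A = (2^-1)%R%:E * (\delta_(-1) A + \delta_(1) A).
Proof.
rewrite /sym_bernoulli /mscale; congr (_ * _).
exact: (eq_trans (measure_addE _ _ _)).
Qed.

Lemma mu_lE (l : R) (l1 : (1 <= l)%R) (A : set T) :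
  mu_l l1 A = ((2 `^ l)^-1)%R%:E * (\delta_(1) A + \delta_(-1) A +
    \int[@lebesgue_measure R]_(x in A) (h_density l x)%:E).
Proof.
rewrite /mu_l /mscale; congr (_ * _).
apply: (eq_trans (measure_addE _ _ _)); congr (_ + _).
exact: (eq_trans (measure_addE _ _ _)).
Qed.

End measures.

(* Main.v *)
Require Import Defs.
From mathcomp Require Import all_boot all_order all_algebra.
From mathcomp Require Import all_classical all_reals all_analysis.
From mathcomp Require Import measurable_realfun complex ring lra.

Import Order.TTheory GRing.Theory Num.Theory.
Import numFieldNormedType.Exports.

Set Implicit Arguments.
Unset Strict Implicit.
Unset Printing Implicit Defensive.

Local Open Scope classical_set_scope.
Local Open Scope ring_scope.

(** Write [g] for the density [h_density l] on [[-1, 1]] and, for a point [z] of the plane cut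
along [(-oo, 1]], put [A = \int (z - x)^(-l) mu_l(dx)],
[B = \int (z - x)^(-l-1) mu_l(dx)] and [G = z / (z^2 - 1)]. Then [A' = - l B] and
[G' / G = - (z^2 + 1) / (z (z^2 - 1))], so the quotient [A / G^l] is locally
constant as soon as [(z^2 + 1) A = z (z^2 - 1) B].

This relation comes from the hypergeometric equation, in a weak form that avoids the behaviour of
[g] at its singular point [0]. If [f0' = (l - 1) f1] and [f1' = l f2] near [[-1, 1]],
then [\int (x (1 - x^2) f2 + 2 (1 - x^2) f1 - x f0) dmu_l = 0] ([mu_l_weak]); for
[f0 = (z - x)^(1-l)], [f1 = (z - x)^(-l)], [f2 = (z - x)^(-l-1)] this is the relation
between [A] and [B] ([transform_relation]). To prove the weak form, expand [g] in its Gauss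
series, whose terms are multiples of [|x|^(2l-1) (1 - x^2)^k]. Two integrations by parts of the
[k]-th term leave the value [f0 1 - f0 (-1)] for [k = 0], which the two atoms cancel, and a
difference of consecutive remainders, because the Gauss coefficients satisfy a two-term recurrence
([radial_by_parts], [sum_radial_by_parts]). The sum telescopes, and the last remainder is of the
order of [k] times the [k]-th term of a convergent positive series whose terms have a rational
quotient, hence tends to [0] ([gauss_boundary_cvg0], [remainder_cvg0]). The same series is a
multiple of [\int g], so [g] is integrable and dominated convergence applies
([integrable_density_series], [h_density_weak]).

To determine the constant for a given [z], follow the segment from [1] to [z], that is the points
[1 + s w] with [w = z - 1] and [0 < s <= 1], which avoids the cut. Near [s = 0] only
the atom at [1], of mass [2^(-l)], contributes to [s^l A], while [s G] tends to [1 / (2 w)];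
so the constant is [2^(-l) w^(-l) (2 w)^l = 1] ([normalized1]). This handles all [z] at once.
All powers are principal ones, and [G] never meets the cut of the power function
([slit_plane_sumV]), so that no branch has to be adjusted. Finally the total mass is the limit of
[z^l A = (z G)^l] as [z] tends to infinity along the reals ([mu_l_mass]). *)

(** * Pointwise calculus *)
(** The usual rules in applied form: derivatives of large expressions are then assembled as terms,
without rewriting functions into point-free form. *)
Section calculus.
Context {R : realType}.
Implicit Types (f g : R -> R) (x : R).

Lemma derive_mul {f g x df dg} : is_derive x 1 f df -> is_derive x 1 g dg ->
  is_derive x 1 (fun t => f t * g t) (df * g x + f x * dg).
Proof.
move=> hf hg; apply: (is_derive_eq (is_deriveM hf hg)).
by rewrite addrC; congr (_ + _); exact: mulrC.
Qed.

Lemma derive_add {f g x df dg} : is_derive x 1 f df -> is_derive x 1 g dg ->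
  is_derive x 1 (fun t => f t + g t) (df + dg).
Proof. by move=> hf hg; exact: is_deriveD. Qed.

Lemma derive_opp {f x df} : is_derive x 1 f df ->
  is_derive x 1 (fun t => - f t) (- df).
Proof. by move=> hf; exact: is_deriveN. Qed.

Lemma derive_const {x} c : is_derive x 1 (fun _ : R => c : R) (0 : R).
Proof. exact: is_derive_cst. Qed.

Lemma derive_var {x} : is_derive x 1 (fun t : R => t : R) (1 : R).
Proof. exact: is_derive_id. Qed.

Lemma derive_expn {f x df} n : is_derive x 1 f df ->
  is_derive x 1 (fun t => f t ^+ n) (n%:R * f x ^+ n.-1 * df).
Proof.
move=> hf; have := is_deriveX n hf.
rewrite (_ : f ^+ n = fun t => f t ^+ n)//.
by apply/funext => t; rewrite exprfctE.
Qed.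

Lemma derive_comp {f g x df dg} : is_derive (g x) 1 f df -> is_derive x 1 g dg ->
  is_derive x 1 (fun t => f (g t)) (df * dg).
Proof.
by move=> hf hg; apply: (is_derive_eq (is_derive1_comp hf hg)); rewrite mulrC.
Qed.

Lemma derive_inv {f x df} : f x != 0 -> is_derive x 1 f df ->
  is_derive x 1 (fun t => (f t)^-1) (- (f x) ^- 2 * df).
Proof. by move=> f0 hf; exact: is_deriveV. Qed.

Lemma derive_continuous {f x df} : is_derive x 1 f df -> {for x, continuous f}.
Proof. by move=> hf; apply/differentiable_continuous/derivable1_diffP. Qed.

End calculus.

(** * Integrals over segments *)
Section FTC.
Context {R : realType}.
Notation mu := (@lebesgue_measure R).

Lemma Rintegral_FTC (F f : R -> R) a b : a < b ->
  (forall x, a <= x <= b -> {for x, continuous f}) ->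
  (forall x, a <= x <= b -> {for x, continuous F}) ->
  (forall x, a < x < b -> is_derive x 1 F (f x)) ->
  \int[mu]_(x in `[a, b]) f x = F b - F a.
Proof.
move=> ab cf cF dF; rewrite /Rintegral (@continuous_FTC2 _ f F)//.
- apply: continuous_in_subspaceT => x; rewrite inE/= in_itv/=; exact: cf.
- split.
  + by move=> x; rewrite in_itv/= => /dF[].
  + by apply: cvg_at_right_filter; apply: cF; rewrite lexx ltW.
  + by apply: cvg_at_left_filter; apply: cF; rewrite lexx ltW.
- by move=> x; rewrite in_itv/= => /dF h; rewrite derive1E derive_val.
Qed.

Lemma integrable_continuous (f : R -> R) a b :
  (forall x, a <= x <= b -> {for x, continuous f}) ->
  mu.-integrable `[a, b] (EFin \o f).
Proof.
move=> cf; apply: continuous_compact_integrable; first exact: segment_compact.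
apply: continuous_in_subspaceT => x; rewrite inE/= in_itv/=; exact: cf.
Qed.

(** Folding at [0] leaves only odd test functions against the singular factor of the density;
their vanishing at [0] is what makes the boundary terms there disappear. *)
Lemma Rintegral_fold (f : R -> R) :
  (forall x, -1 <= x <= 1 -> {for x, continuous f}) ->
  \int[mu]_(x in `[-1, 1]) f x = \int[mu]_(x in `[0, 1]) (f x + f (- x)).
Proof.
move=> cf.
have cf0 x : 0 <= x <= 1 -> {for x, continuous f}.
  by move=> /andP[x0 x1]; apply: cf; lra.
have cfN x : 0 <= x <= 1 -> {for x, continuous (f \o -%R)}.
  move=> /andP[x0 x1]; apply: continuous_comp; last by apply: cf; lra.
  exact: opp_continuous.
rewrite [RHS]RintegralD//; [|exact: integrable_continuous..].
have iT : mu.-integrable `[-1, 1] (EFin \o f) by exact: integrable_continuous.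
have -> : \int[mu]_(x in `[0, 1]) f (- x) = \int[mu]_(x in `[-1, 0]) f x.
  rewrite /Rintegral.
  have := @integration_by_substitution_oppr R f 0 1 ler01.
  rewrite oppr0 => ->//.
  apply: continuous_in_subspaceT => x; rewrite inE/= in_itv/= => /andP[x0 x1].
  by apply: cf; lra.
have -> : `[-1, 1]%classic = `[-1, 0] `|` `]0, 1] :> set R.
  by rewrite -itv_bndbnd_setU// bnd_simp; lra.
rewrite Rintegral_setU//; first last.
- rewrite disj_set2E; apply/eqP; rewrite -subset0 => x/= []; rewrite !in_itv/=; lra.
- apply: integrableS iT => //; first exact: measurableU.
  by move=> x/= []; rewrite !in_itv/=; lra.
rewrite addrC; congr (_ + _); rewrite Rintegral_itv_obnd_cbnd//.
by apply: integrableS (integrable_continuous cf0) => // x/=; rewrite !in_itv/=; lra.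
Qed.

End FTC.

(** * Real powers and series with rational quotients *)
Section powers.
Context {R : realType}.

Lemma continuous_abs_powR (r : R) : 0 < r -> continuous (fun x : R => `|x| `^ r).
Proof.
move=> r0 x; have [->|x0] := eqVneq x 0.
  apply/cvgrPdist_lt => e e0.
  have er0 : 0 < e `^ r^-1 by rewrite powR_gt0.
  exists (e `^ r^-1) => //= t; rewrite /ball/= sub0r normrN => te.
  rewrite normr0 powR0 ?gt_eqF// sub0r normrN ger0_norm ?powR_ge0//.
  have := gt0_ltr_powR r0; move=> /(_ `|t| (e `^ r^-1)).
  rewrite !nnegrE normr_ge0 powR_ge0 => /(_ isT isT te).
  by rewrite -powRrM mulVf ?gt_eqF// powRr1// ltW.
have xp : 0 < `|x| by rewrite normr_gt0.
apply: (@continuous_comp _ _ _ (@Num.norm R R) (fun t => t `^ r)).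
  exact: norm_continuous.
exact: (derive_continuous (is_derive1_powR r xp)).
Qed.

Lemma derive_abs_powR (r x : R) : 0 < x ->
  is_derive x 1 (fun t : R => `|t| `^ r) (r * `|x| `^ (r - 1)).
Proof.
move=> x0; rewrite (gtr0_norm x0).
apply: (near_eq_is_derive _ (is_derive1_powR r x0)).
by near=> t; rewrite gtr0_norm//; near: t; exact: lt_nbhsr.
Unshelve. all: by end_near. Qed.

End powers.

(** [T] has the quotients of the terms at [1] of a Gauss series whose parameters have excess
[l + 3 - (l + 3 / 2) = 3 / 2]; everything follows from comparing [T k] with the
decrease of [(k + 1) T k]. *)
Section gauss_ratio.
Context {R : realType}.
Variables (l : R) (T : nat -> R).
Hypothesis T_ge0 : forall k, 0 <= T k.
Hypothesis T_rec : forall k, T k.+1 * ((k%:R + 2) * (k%:R + 1 + l)) =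
  T k * ((l / 2 + 1 + k%:R) * ((l + 1) / 2 + k%:R)).
Hypothesis l_ge1 : 1 <= l.

Let U k := (k%:R + 1) * T k.

Let U_ge0 k : 0 <= U k.
Proof. by rewrite mulr_ge0// addr_ge0. Qed.

(* The decrease is [T k (k / 2 + (l + 1) (2 - l) / 4) / (k + 1 + l)]; the factor of [T k] tends to
   [1 / 2], and exceeds [1 / 4] from [l ^ 2] on. *)
Let U_diff k : l ^+ 2 <= k%:R -> T k <= 4 * (U k - U k.+1).
Proof.
move=> lk; have k0 : 0 <= k%:R :> R := ler0n _ _.
have p : 0 < k%:R + 1 + l by move: l_ge1 => l1; lra.
have -> : U k.+1 = T k * ((l / 2 + 1 + k%:R) * ((l + 1) / 2 + k%:R)) / (k%:R + 1 + l).
  by rewrite -T_rec /U -natr1; field; rewrite gt_eqF.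
have -> : 4 * (U k - T k * ((l / 2 + 1 + k%:R) * ((l + 1) / 2 + k%:R)) / (k%:R + 1 + l))
   = T k + T k * ((k%:R - l ^+ 2 + 1) / (k%:R + 1 + l)).
  by rewrite /U; field; rewrite gt_eqF.
rewrite lerDl mulr_ge0// divr_ge0 ?ltW//; lra.
Qed.

Let K := (Num.truncn (l ^+ 2)).+1.

Let K_le n : (K <= n)%N -> l ^+ 2 <= n%:R.
Proof.
by move=> Kn; apply/ltW/(lt_le_trans (truncnS_gt _)); rewrite ler_nat.
Qed.

Lemma cvg_series_gauss : cvgn (series T).
Proof.
have nd : nondecreasing_seq (series T) by apply: nondecreasing_series => n _ _.
apply: nondecreasing_is_cvgn => //.
exists (series T K + 4 * U K) => _ [n _ <-].
have [nK|Kn] := leqP n K.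
  apply: (@le_trans _ _ (series T K)); last by rewrite lerDl mulr_ge0.
  exact: nd.
rewrite -(subnK (ltnW Kn)); elim: (n - K)%N => [|m ih].
  by rewrite add0n lerDl mulr_ge0.
suff : forall m, series T (m + K) <= series T K + 4 * (U K - U (m + K)).
  by move=> /(_ m.+1)/le_trans; apply; rewrite lerD2l ler_pM2l// gerBl.
elim=> [|j jh]; first by rewrite add0n subrr mulr0 addr0.
rewrite addSn -[series _ _.+1]/(\sum_(0 <= i < (j + K).+1) T i) big_nat_recr//=.
have := @U_diff (j + K) (K_le (leq_addl _ _)).
by move: jh; rewrite /series/=; lra.
Qed.

(** The sequence is eventually decreasing; a positive limit [c] would give
[T k >= c / (k + 1)], against the divergence of the harmonic series. *)
Lemma gauss_boundary_cvg0 : (fun k => (k%:R + 1) * T k) @ \oo --> 0.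
Proof.
have Ud n m : (K <= n)%N -> (n <= m)%N -> U m <= U n.
  move=> Kn /subnK <-; elim: (m - n)%N => [|j]; first by rewrite add0n.
  apply: le_trans; rewrite addSn.
  have := @U_diff (j + n) (K_le (leq_trans Kn (leq_addl _ _))).
  by have := T_ge0 (j + n); lra.
have cU : cvgn U.
  apply: (@near_nonincreasing_is_cvgn _ _ 0); last exact: nearW.
  exists K => // n/= Kn m; exact: Ud.
suff -> : 0 = limn U by [].
apply/esym/eqP; rewrite eq_le; apply/andP; split; last first.
  by apply: limr_ge => //; exact: nearW.
rewrite leNgt; apply/negP => c0; set c := limn U in c0.
have cle n : (K <= n)%N -> c <= U n.
  by move=> Kn; apply: limr_le => //; exists n => // m /= nm; exact: Ud.
apply: (@dvg_harmonic R); rewrite -(is_cvg_series_restrict K).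
pose u n : R := if (n < K)%N then 0 else harmonic n.
have -> : [sequence \sum_(K <= k < n) harmonic k]_n =
         [sequence \sum_(K <= k < n) u k]_n :> (R ^nat).
  apply/funext => n /=; rewrite big_nat_cond [RHS]big_nat_cond.
  by apply: eq_bigr => i /andP[/andP[Ki _] _]; rewrite /u ltnNge Ki.
rewrite is_cvg_series_restrict.
apply: (@series_le_cvg _ _ (fun n => c^-1 * T n)).
- by rewrite /u => n; case: ifPn => // _; exact: harmonic_ge0.
- by move=> n; rewrite mulr_ge0// invr_ge0 ltW.
- rewrite /u => n; case: ltnP => [_|Kn /=]; first by rewrite mulr_ge0// invr_ge0 ltW.
  rewrite ler_pdivlMl// ler_pdivrMr ?ltr0n// -natr1 mulrC; exact: cle.
- have := @is_cvg_seriesZ _ T c^-1 cvg_series_gauss.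
  by congr (cvgn (series _)); apply/funext => n; rewrite fctE.
Qed.

End gauss_ratio.

(** * Moments of the terms of the density *)
Section radial_monomials.
Context {R : realType}.
Variable l : R.
Hypothesis l1 : 1 < l.
Implicit Types (x : R) (k : nat).
Notation mu := (@lebesgue_measure R).

Definition gauss_coef (k : nat) : R := hyp2F1_coef (l / 2 + 1) ((l + 1) / 2) 2 k.

(** With [x ^ 2] for the variable and [1 - x ^ 2] for the argument of the Gauss series, the
[k]-th term of the density is a multiple of this function; the absolute value makes it continuous
at [0]. *)
Definition radial (k : nat) (x : R) : R := `|x| `^ (2 * l - 1) * (1 - x ^+ 2) ^+ k.

Definition moment (k : nat) : R := \int[mu]_(x in `[0, 1]) radial k x.

Lemma gauss_coef_ge0 k : 0 <= gauss_coef k.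
Proof.
by move: l1 => h1; apply: hyp2F1_coef_ge0; rewrite ?addr_ge0 ?divr_ge0//; lra.
Qed.

Lemma pochhammerS (a : R) n : pochhammer a n.+1 = pochhammer a n * (a + n%:R).
Proof. by rewrite /pochhammer big_ord_recr. Qed.

Lemma gauss_coef_rec k : gauss_coef k.+1 * ((k%:R + 2) * (k%:R + 1)) =
  gauss_coef k * ((l / 2 + 1 + k%:R) * ((l + 1) / 2 + k%:R)).
Proof.
have p2 n : pochhammer (2 : R) n != 0.
  by apply/prodf_neq0 => i _; rewrite gt_eqF// ltr_wpDr.
have k0 : 0 <= k%:R :> R := ler0n _ _.
have f0 n : n`!%:R != 0 :> R by rewrite pnatr_eq0 -lt0n fact_gt0.
rewrite /gauss_coef /hyp2F1_coef !pochhammerS factS natrM -natr1; field.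
by rewrite p2 f0 !gt_eqF//=; lra.
Qed.

Lemma continuous_subX2 k : continuous (fun x : R => (1 - x ^+ 2) ^+ k).
Proof.
by move=> x; exact: (derive_continuous (derive_expn k (derive_add (derive_const 1)
  (derive_opp (derive_expn 2 derive_var))))).
Qed.

Lemma continuous_radial k : continuous (radial k).
Proof.
move=> x; apply: cvgM; last exact: continuous_subX2.
by apply: continuous_abs_powR; move: l1 => h1; lra.
Qed.

Lemma radial_ge0 k x : -1 <= x <= 1 -> 0 <= radial k x.
Proof.
by move=> x1; rewrite mulr_ge0 ?powR_ge0// exprn_ge0//; nra.
Qed.

Lemma abs_powR_2l x : 0 <= x -> `|x| `^ (2 * l) = x * `|x| `^ (2 * l - 1).
Proof.
move=> x0; rewrite (ger0_norm x0) mulr_powRB1//.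
by move: l1 => h1; lra.
Qed.

Lemma derive_abs_2l x : 0 < x ->
  is_derive x 1 (fun t : R => `|t| `^ (2 * l)) (2 * l * `|x| `^ (2 * l - 1)).
Proof. exact: derive_abs_powR. Qed.

Lemma derive_subX2 k x : is_derive x 1 (fun t : R => (1 - t ^+ 2) ^+ k)
  (- (2 * k%:R * x * (1 - x ^+ 2) ^+ k.-1)).
Proof.
apply: is_derive_eq.
  exact: (derive_expn k (derive_add (derive_const 1) (derive_opp (derive_expn 2 derive_var)))).
by rewrite /= expr1; ring.
Qed.

Lemma continuous_abs_2l : continuous (fun x : R => `|x| `^ (2 * l)).
Proof. by apply: continuous_abs_powR; move: l1 => h1; lra. Qed.

Lemma integrable_radial k a b : mu.-integrable `[a, b] (EFin \o radial k).
Proof. by apply: integrable_continuous => x _; exact: continuous_radial. Qed.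

Lemma moment_ge0 k : 0 <= moment k.
Proof.
apply: Rintegral_ge0 => x/=; rewrite in_itv/= => /andP[x0 x1].
by apply: radial_ge0; lra.
Qed.

(** The primitive [|x|^(2l) (1 - x^2)^(k+1)] vanishes at both ends of [[0, 1]]. *)
Lemma moment_rec k : (l + k%:R + 1) * moment k.+1 = (k%:R + 1) * moment k.
Proof.
pose F (x : R) := `|x| `^ (2 * l) * (1 - x ^+ 2) ^+ k.+1.
pose f (x : R) := 2 * (l + k%:R + 1) * radial k.+1 x - 2 * (k%:R + 1) * radial k x.
have dF x : 0 < x < 1 -> is_derive x 1 F (f x).
  move=> /andP[x0 x1]; apply: is_derive_eq.
    exact: (derive_mul (derive_abs_2l x0) (derive_subX2 k.+1 x)).
  by rewrite /f /radial abs_powR_2l 1?ltW//= exprS -natr1; ring.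
have cmul (c : R) j : continuous (fun x => c * radial j x).
  by move=> x; apply: cvgM; [exact: cvg_cst|exact: continuous_radial].
have := Rintegral_FTC ltr01 _ _ dF.
rewrite /F expr1n subrr expr0n/= mulr0 normr0 powR0 ?mul0r ?subrr; last first.
  by move: l1 => h1; rewrite gt_eqF//; lra.
rewrite RintegralB//; last 2 first.
- by apply: integrable_continuous => x _; exact: cmul.
- by apply: integrable_continuous => x _; exact: cmul.
rewrite !RintegralZl//; [|exact: integrable_radial..].
rewrite -/(moment _) -/(moment _) => h.
suff : 2 * (l + k%:R + 1) * moment k.+1 - 2 * (k%:R + 1) * moment k = 0 by lra.
apply: h => x _.
- by apply: cvgB; exact: cmul.
- by apply: cvgM; [exact: continuous_abs_2l|exact: continuous_subX2].
Qed.

Definition gauss_term (k : nat) : R := gauss_coef k * moment k.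

Lemma gauss_term_ge0 k : 0 <= gauss_term k.
Proof. by rewrite mulr_ge0 ?gauss_coef_ge0 ?moment_ge0. Qed.

Lemma gauss_term_rec k : gauss_term k.+1 * ((k%:R + 2) * (k%:R + 1 + l)) =
  gauss_term k * ((l / 2 + 1 + k%:R) * ((l + 1) / 2 + k%:R)).
Proof.
have k1 : k%:R + 1 != 0 :> R by rewrite natr1 pnatr_eq0.
apply: (mulIf k1); rewrite /gauss_term.
transitivity (gauss_coef k.+1 * ((k%:R + 2) * (k%:R + 1)) *
  ((l + k%:R + 1) * moment k.+1)); first by ring.
by rewrite gauss_coef_rec moment_rec; ring.
Qed.

End radial_monomials.

(** * Double integration by parts *)
(** [q0], [q1], [q2] are twice the odd, even and odd parts of the test functions of
[h_density_weak]; the integrals are folded onto [[0, 1]]. *)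
Section telescoping.
Context {R : realType}.
Variable l : R.
Hypothesis l1 : 1 < l.
Variables q0 q1 q2 : R -> R.
Hypothesis dq0 : forall x : R, 0 <= x <= 1 -> is_derive x 1 q0 ((l - 1) * q1 x).
Hypothesis dq1 : forall x : R, 0 <= x <= 1 -> is_derive x 1 q1 (l * q2 x).
Hypothesis cq2 : forall x : R, 0 <= x <= 1 -> {for x, continuous q2}.
Implicit Types (x : R) (k : nat).
Notation mu := (@lebesgue_measure R).

Definition weak_integrand (f0 f1 f2 : R -> R) x : R :=
  x * (1 - x ^+ 2) * f2 x + 2 * (1 - x ^+ 2) * f1 x - x * f0 x.

Let cq0 x : 0 <= x <= 1 -> {for x, continuous q0}.
Proof. by move=> /dq0; exact: derive_continuous. Qed.

Let cq1 x : 0 <= x <= 1 -> {for x, continuous q1}.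
Proof. by move=> /dq1; exact: derive_continuous. Qed.

Lemma continuous_weak_integrand (f0 f1 f2 : R -> R) x :
  {for x, continuous f0} -> {for x, continuous f1} -> {for x, continuous f2} ->
  {for x, continuous (weak_integrand f0 f1 f2)}.
Proof.
have cx : {for x, continuous (fun t : R => t)} by exact: cvg_id.
have cu : {for x, continuous (fun t : R => 1 - t ^+ 2)}.
  exact: (derive_continuous (derive_add (derive_const 1)
    (derive_opp (derive_expn 2 derive_var)))).
move=> c0 c1 c2; apply: cvgB; last exact: cvgM.
apply: cvgD; apply: cvgM => //; apply: cvgM => //; exact: cvg_cst.
Qed.

(** What is left of the test function when the [k]-th term is integrated by parts twice. *)
Let rest k : R := \int[mu]_(x in `[0, 1]) (q0 x * (`|x| `^ (2 * l) * (1 - x ^+ 2) ^+ k)).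

Let continuous_rest k x : 0 <= x <= 1 ->
  {for x, continuous (fun x => q0 x * (`|x| `^ (2 * l) * (1 - x ^+ 2) ^+ k))}.
Proof.
move=> x01; apply: cvgM; first exact: cq0.
by apply: cvgM; [exact: continuous_abs_2l|exact: continuous_subX2].
Qed.

Let remainder k : R := 4 * k%:R * (k%:R + 1) * gauss_coef l k * rest k.-1.

(** Here [k] and [k - 1] enter with coefficients that become equal up to a shift of [k], once
multiplied by the Gauss coefficients: this is the hypergeometric equation read term by term. *)
Lemma radial_by_parts k :
  l * (l - 1) * \int[mu]_(x in `[0, 1]) (weak_integrand q0 q1 q2 x * radial l k x) =
  2 * q0 1 *+ (k == 0)%N -
  4 * (l / 2 + 1 + k%:R) * ((l + 1) / 2 + k%:R) * rest k
  + 4 * (k%:R + 1) * k%:R * rest k.-1.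
Proof.
have l2 : 0 < 2 * l by move: l1 => h1; lra.
(* The boundary terms of the two integrations by parts.  At [1] the first one vanishes and the
   second one survives only for [k = 0]; both vanish at [0]. *)
pose F x := (l - 1) * (`|x| `^ (2 * l) * (1 - x ^+ 2) ^+ k.+1) * q1 x +
  2 * (k%:R + 1) * x * (`|x| `^ (2 * l) * (1 - x ^+ 2) ^+ k) * q0 x.
pose w x := weak_integrand q0 q1 q2 x * radial l k x.
pose r k x := q0 x * (`|x| `^ (2 * l) * (1 - x ^+ 2) ^+ k).
have cw x : 0 <= x <= 1 -> {for x, continuous w}.
  move=> x01; apply: cvgM; last exact: continuous_radial.
  by apply: continuous_weak_integrand; [exact: cq0|exact: cq1|exact: cq2].
pose c := 4 * (l / 2 + 1 + k%:R) * ((l + 1) / 2 + k%:R).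
pose d := 4 * (k%:R + 1) * k%:R : R.
pose f x := l * (l - 1) * w x + (c * r k x - d * r k.-1 x).
have dP j x : 0 < x -> is_derive x 1 (fun t : R => `|t| `^ (2 * l) * (1 - t ^+ 2) ^+ j)
    (2 * l * `|x| `^ (2 * l - 1) * (1 - x ^+ 2) ^+ j +
     `|x| `^ (2 * l) * - (2 * j%:R * x * (1 - x ^+ 2) ^+ j.-1)).
  by move=> x0; exact: (derive_mul (derive_abs_2l l x0) (derive_subX2 j x)).
have dF x : 0 < x < 1 -> is_derive x 1 F (f x).
  move=> /andP[x0 x1]; have x01 : 0 <= x <= 1 by lra.
  apply: is_derive_eq.
    apply: derive_add; apply: derive_mul.
    - exact: (derive_mul (derive_const (l - 1)) (dP k.+1 _ x0)).
    - exact: dq1.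
    - exact: (derive_mul (derive_mul (derive_const (2 * (k%:R + 1))) derive_var) (dP k _ x0)).
    - exact: dq0.
  rewrite /f /w /r /c /d /weak_integrand /radial abs_powR_2l 1?ltW//=.
  set P := _ `^ (_ - 1); set u := 1 - x ^+ 2.
  have xu : x ^+ 2 = 1 - u by rewrite /u; ring.
  clear F cw f c d w r dP.
  clearbody P u; case: k => [|n] /=; rewrite ?exprS ?expr0.
  - by field: xu.
  - by rewrite -[n.+2%:R]natr1 -[n.+1%:R]natr1; set U := u ^+ n; field: xu.
have F0 : F 0 = 0 by rewrite /F normr0 powR0 ?gt_eqF//; ring.
have F1 : F 1 = 2 * q0 1 *+ (k == 0)%N.
  rewrite /F expr1n subrr normr1 powR1 !expr0n; case: (k) => [|n]/=; ring.
have cr j x : 0 <= x <= 1 -> {for x, continuous (r j)} by exact: continuous_rest.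
have cZ (e : R) (g : R -> R) x : {for x, continuous g} -> {for x, continuous (fun t => e * g t)}.
  by move=> cg; apply: cvgM => //; exact: cvg_cst.
have := Rintegral_FTC ltr01 _ _ dF; rewrite F0 F1 subr0 => <-; first last.
- move=> x x01; apply: cvgD; apply: cvgM; [|exact: cq1| |exact: cq0].
    apply: cvgM; first exact: cvg_cst.
    by apply: cvgM; [exact: continuous_abs_2l|exact: continuous_subX2].
  apply: cvgM; first by apply: cvgM; [exact: cvg_cst|exact: cvg_id].
  by apply: cvgM; [exact: continuous_abs_2l|exact: continuous_subX2].
- move=> x x01; apply: cvgD; first exact: cZ (cw _ x01).
  by apply: cvgB; exact: cZ (cr _ _ x01).
have ir j : mu.-integrable `[0, 1] (EFin \o r j).
  exact: (@integrable_continuous _ (r j) 0 1 (cr j)).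
have iZr (e : R) j : mu.-integrable `[0, 1] (EFin \o (fun x => e * r j x)).
  by apply: integrable_continuous => x x01; apply: cZ; exact: cr.
rewrite RintegralD//; last 2 first.
- by apply: integrable_continuous => x x01; apply: cZ; exact: cw.
- by apply: integrable_continuous => x x01; apply: cvgB; apply: cZ; exact: cr.
rewrite RintegralB// !RintegralZl//; last exact: integrable_continuous.
by rewrite -!/(rest _) /c /d; ring.
Qed.

Lemma sum_radial_by_parts n :
  l * (l - 1) * \sum_(k < n.+1)
    gauss_coef l k * \int[mu]_(x in `[0, 1]) (weak_integrand q0 q1 q2 x * radial l k x) =
  2 * q0 1 - remainder n.+1.
Proof.
have remS k : remainder k.+1 =
    4 * (l / 2 + 1 + k%:R) * ((l + 1) / 2 + k%:R) * gauss_coef l k * rest k.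
  transitivity (4 * (gauss_coef l k.+1 * ((k%:R + 2) * (k%:R + 1))) * rest k).
    by rewrite /remainder -natr1/=; ring.
  by rewrite gauss_coef_rec//; ring.
have step k : l * (l - 1) *
    (gauss_coef l k * \int[mu]_(x in `[0, 1]) (weak_integrand q0 q1 q2 x * radial l k x)) =
    2 * q0 1 *+ (k == 0)%N + remainder k - remainder k.+1.
  have c0 : gauss_coef l 0 = 1.
    by rewrite /gauss_coef /hyp2F1_coef /pochhammer !big_ord0 fact0 !divr1 mulr1.
  rewrite mulrCA radial_by_parts remS {1}/remainder.
  by case: k => [|k]; rewrite ?c0/=; ring.
elim: n => [|n ih].
  by rewrite big_ord1 step/= {1}/remainder; ring.
by rewrite big_ord_recr mulrDr ih step/=; ring.
Qed.

(** The linear bound at [0] trades a factor [x] of [q0] for a factor [1 / k], which brings the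
remainder down to [(k + 1)] times the [k]-th term of the convergent series. *)
Lemma remainder_cvg0 (C : R) : (forall x, 0 <= x <= 1 -> `|q0 x| <= C * x) ->
  remainder @ \oo --> 0.
Proof.
move=> q0C; have C0 : 0 <= C.
  by have := q0C 1; rewrite ler01 lexx mulr1 => /(_ isT); apply: le_trans.
have restC k : `|rest k| <= C * (moment l k - moment l k.+1).
  have ix : mu.-integrable `[0, 1] (EFin \o (fun x => C * (radial l k x - radial l k.+1 x))).
    apply: integrable_continuous => x _; apply: cvgM; first exact: cvg_cst.
    by apply: cvgB; exact: continuous_radial.
  have <- : \int[mu]_(x in `[0, 1]) (C * (radial l k x - radial l k.+1 x)) =
      C * (moment l k - moment l k.+1).
    rewrite RintegralZl//; last first.
      by apply: integrable_continuous => x _; apply: cvgB; exact: continuous_radial.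
    by rewrite RintegralB//; exact: integrable_radial.
  apply: (le_trans (le_normr_Rintegral _ _)) => //.
    exact/integrable_continuous/continuous_rest.
  apply: le_Rintegral => //.
  - apply: integrable_continuous => x x01.
    by apply: cvg_norm; exact: continuous_rest.
  - move=> x /=; rewrite in_itv/= => x01; have /andP[x0 x1] := x01.
    have P0 : 0 <= `|x| `^ (2 * l - 1) by exact: powR_ge0.
    have u0 : 0 <= (1 - x ^+ 2) ^+ k by rewrite exprn_ge0//; nra.
    rewrite abs_powR_2l// /radial [_ ^+ k.+1]exprS !normrM (ger0_norm P0) (ger0_norm u0).
    rewrite (ger0_norm x0).
    have -> : C * (x `^ (2 * l - 1) * (1 - x ^+ 2) ^+ k -
      x `^ (2 * l - 1) * ((1 - x ^+ 2) * (1 - x ^+ 2) ^+ k)) =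
      C * x * (x * x `^ (2 * l - 1) * (1 - x ^+ 2) ^+ k) by ring.
    rewrite (ger0_norm x0) in P0.
    by apply: ler_wpM2r; [rewrite !mulr_ge0|exact: q0C].
have bnd k : `|remainder k.+1| <= 4 * C * l * ((k.+1%:R + 1) * gauss_term l k.+1).
  have p0 : 0 <= 4 * k.+1%:R * (k.+1%:R + 1) * gauss_coef l k.+1.
    by apply: mulr_ge0; [apply: mulr_ge0; [exact: mulr_ge0|exact: addr_ge0]|exact: gauss_coef_ge0].
  rewrite /remainder normrM (ger0_norm p0).
  apply: le_trans (ler_wpM2l p0 (restC _)) _.
  rewrite /gauss_term -[k.+1%:R]natr1 le_eqVlt; apply/orP; left; apply/eqP.
  have := moment_rec l1 k; rewrite -/(moment _ _) => h.
  have {h} : (k%:R + 1) * (moment l k - moment l k.+1) = l * moment l k.+1 by lra.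
  move=> h; transitivity (4 * (k%:R + 1 + 1) * gauss_coef l k.+1 * C *
    ((k%:R + 1) * (moment l k - moment l k.+1))); first by rewrite /=; ring.
  by rewrite h; ring.
have cv : (fun k => 4 * C * l * ((k.+1%:R + 1) * gauss_term l k.+1)) @ \oo --> 0.
  rewrite -(mulr0 (4 * C * l)); apply: cvgM; first exact: cvg_cst.
  have := gauss_boundary_cvg0 (gauss_term_ge0 l1) (gauss_term_rec l1) (ltW l1).
  by rewrite -cvg_shiftS.
rewrite -cvg_shiftS; apply: norm_cvg0.
apply: squeeze_cvgr (cvg_cst 0) cv; apply: nearW => k.
by rewrite normr_ge0 bnd.
Qed.

Lemma sum_radial_by_parts_cvg (C : R) :
  (forall x, 0 <= x <= 1 -> `|q0 x| <= C * x) ->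
  (fun n => l * (l - 1) * \sum_(k < n.+1) gauss_coef l k *
    \int[mu]_(x in `[0, 1]) (weak_integrand q0 q1 q2 x * radial l k x)) @ \oo --> 2 * q0 1.
Proof.
move=> q0C; under eq_fun do rewrite sum_radial_by_parts.
have := remainder_cvg0 q0C; rewrite -cvg_shiftS => /(cvgB (cvg_cst (2 * q0 1))).
by rewrite subr0.
Qed.

End telescoping.

(** * Integrability and weak equation of the density *)
Section density.
Context {R : realType}.
Implicit Types (l x : R) (k : nat).
Notation mu := (@lebesgue_measure R).

Lemma bounded_on_segment (f : R -> R) (a b : R) : a <= b ->
  (forall x, a <= x <= b -> {for x, continuous f}) ->
  exists2 M, 0 <= M & forall x, a <= x <= b -> `|f x| <= M.
Proof.
move=> ab cf; have [|c cab cP] := @EVT_max R (fun x => `|f x|) a b ab.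
  apply: continuous_in_subspaceT => x; rewrite inE/= in_itv/= => xab.
  by apply: cvg_norm; exact: cf.
by exists `|f c| => // x xab; apply: cP; rewrite in_itv.
Qed.

Lemma fine_mull (r : R) (y : \bar R) : fine (r%:E * y)%E = r * fine y.
Proof.
case: y => [y| |] /=; first by [].
- have [r0|r0|->] := ltgtP r 0; last by rewrite mul0e mulr0.
  + by rewrite lt0_muley ?lte_fin//= mulr0.
  + by rewrite gt0_muley ?lte_fin//= mulr0.
- have [r0|r0|->] := ltgtP r 0; last by rewrite mul0e mulr0.
  + by rewrite lt0_muleNy ?lte_fin//= mulr0.
  + by rewrite gt0_muleNy ?lte_fin//= mulr0.
Qed.

Definition density_term l k x : R := l * (l - 1) / 2 * gauss_coef l k * radial l k x.

(** The series is taken in the extended reals: its integrability then gives its convergence almost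
everywhere. *)
Definition density_series l x : \bar R := (\sum_(0 <= k <oo) (density_term l k x)%:E)%E.

Lemma density_term_ge0 l k x : 1 < l -> -1 <= x <= 1 -> 0 <= density_term l k x.
Proof.
move=> l1 x1; apply: mulr_ge0; last exact: radial_ge0.
apply: mulr_ge0; last exact: gauss_coef_ge0.
by apply: mulr_ge0 => //; nra.
Qed.

Lemma continuous_density_term l k : 1 < l -> continuous (density_term l k).
Proof.
by move=> l1 x; apply: cvgM; [exact: cvg_cst|exact: continuous_radial].
Qed.

Lemma h_densityE l x : 1 < l -> -1 <= x <= 1 ->
  h_density l x = fine (density_series l x).
Proof.
move=> l1 x1; have u0 : 0 <= 1 - x ^+ 2 by nra.
have xx : x ^+ 2 \in `[0, 1]%classic by rewrite inE/= in_itv/= sqr_ge0/=; lra.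
rewrite /h_density /hfun indicE xx mulr1 hyp2F1_fine//; try lra.
have -> : 2 * `|x| * (l * (l - 1) / 4 * (x ^+ 2) `^ (l - 1) *
    fine (\sum_(0 <= n <oo) (hyp2F1_coef (l / 2 + 1) ((l + 1) / 2) 2 n * (1 - x ^+ 2) ^+ n)%:E)%E) =
  l * (l - 1) / 2 * `|x| `^ (2 * l - 1) *
    fine (\sum_(0 <= n <oo) (hyp2F1_coef (l / 2 + 1) ((l + 1) / 2) 2 n * (1 - x ^+ 2) ^+ n)%:E)%E.
  have -> : `|x| `^ (2 * l - 1) = `|x| * (x ^+ 2) `^ (l - 1).
    rewrite -mulr_powRB1//; last lra.
    by rewrite -real_normK ?num_real// -powR_mulrn// -powRrM; congr (_ * _ `^ _); ring.
  by field.
rewrite -fine_mull -nneseriesZl; last first.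
  by move=> n _; rewrite lee_fin mulr_ge0 ?exprn_ge0// (gauss_coef_ge0 l1).
congr (fine _); apply: eq_eseriesr => n _; rewrite -EFinM; congr (_%:E).
by rewrite /density_term /radial /gauss_coef; ring.
Qed.

Lemma integral_density_term l k : 1 < l ->
  (\int[mu]_(x in `[(-1)%R, 1%R]) (density_term l k x)%:E = (l * (l - 1) * gauss_term l k)%:E)%E.
Proof.
move=> l1; have cT x : {for x, continuous (density_term l k)}.
  exact: continuous_density_term.
rewrite -[LHS]fineK; last first.
  by apply: integrable_fin_num => //; exact: integrable_continuous.
congr (_%:E); rewrite -/(Rintegral _ _ _) Rintegral_fold//.
under eq_Rintegral => x _.
  rewrite (_ : _ + _ = l * (l - 1) * gauss_coef l k * radial l k x); last first.
    by rewrite /density_term /radial normrN sqrrN; field.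
  over.
by rewrite RintegralZl//; [rewrite -/(moment _ _) /gauss_term; ring|exact: integrable_radial].
Qed.

Lemma measurable_density_series l : 1 < l ->
  measurable_fun (`[-1, 1] : set R) (density_series l).
Proof.
move=> l1; apply: ge0_emeasurable_sum => [k x /=|k _].
  by rewrite in_itv/= => x1 _; rewrite lee_fin; exact: density_term_ge0.
apply/measurable_EFinP; apply: measurable_funTS; apply: continuous_measurable_fun.
exact: continuous_density_term.
Qed.

Lemma integrable_density_series l : 1 < l ->
  mu.-integrable `[-1, 1] (density_series l).
Proof.
move=> l1; apply/integrableP; split; first exact: measurable_density_series.
under eq_integral => x.
  rewrite inE/= in_itv/= => x1; rewrite gee0_abs; last first.
    by apply: nneseries_ge0 => k _ _; rewrite lee_fin density_term_ge0.
  over.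
rewrite integral_nneseries//; first last.
- by move=> k x /=; rewrite in_itv/= => x1; rewrite lee_fin; exact: density_term_ge0.
- move=> k; apply/measurable_EFinP; apply: measurable_funTS; apply: continuous_measurable_fun.
  exact: continuous_density_term.
under eq_eseriesr do rewrite integral_density_term//.
have cv : cvgn (series (fun k => l * (l - 1) * gauss_term l k)).
  have -> : (fun k => l * (l - 1) * gauss_term l k) = (l * (l - 1)) *: gauss_term l by [].
  apply: is_cvg_seriesZ.
  exact: cvg_series_gauss (gauss_term_ge0 l1) (gauss_term_rec l1) (ltW l1).
rewrite (_ : (fun n => _) = EFin \o series (fun k => l * (l - 1) * gauss_term l k)).
  by rewrite EFin_lim// ltry.
by apply/funext => n /=; rewrite sumEFin.
Qed.

Lemma h_density1 x : h_density 1 x = 0.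
Proof. by rewrite /h_density /hfun subrr mulr0 !mul0r mulr0. Qed.

Lemma integrable_h_density l : 1 <= l -> mu.-integrable `[-1, 1] (EFin \o h_density l).
Proof.
rewrite le_eqVlt => /predU1P[<-|l1].
  apply: (eq_integrable _ (cst 0%E)) => //; last exact: integrable0.
  by move=> x _ /=; rewrite h_density1.
apply: (@le_integrable _ _ _ mu _ _ _ (density_series l)) => //;
  last exact: integrable_density_series.
  apply/measurable_EFinP; apply: measurable_funTS; exact: (measurable_h_density (ltW l1)).
move=> x/=; rewrite in_itv/= => x1.
rewrite h_densityE//; case: (density_series l x) => [r| |]//=.
- by rewrite normr0 leey.
- by rewrite normr0 leey.
Qed.


(** A second order equation for the density in the weak sense. Its boundary values at [1] and [-1]
are those that the atoms of the measure produce with the opposite sign. For [l = 1] the density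
is zero and [f0] is constant. *)
Lemma h_density_weak l (f0 f1 f2 : R -> R) : 1 <= l ->
  (forall x, -1 <= x <= 1 -> is_derive x 1 f0 ((l - 1) * f1 x)) ->
  (forall x, -1 <= x <= 1 -> is_derive x 1 f1 (l * f2 x)) ->
  (forall x, -1 <= x <= 1 -> {for x, continuous f2}) ->
  \int[mu]_(x in `[-1, 1]) (weak_integrand f0 f1 f2 x * h_density l x) =
  f0 1 - f0 (-1).
Proof.
rewrite le_eqVlt => /predU1P[<-|l1] df0 df1 cf2.
  under eq_Rintegral do rewrite h_density1 mulr0.
  rewrite Rintegral_cst// mul0r; apply/esym/eqP.
  have [|x| |x c ->] := @MVT_segment R f0 (fun x => (1 - 1) * f1 x) (-1) 1.
  - by lra.
  - by rewrite in_itv/= => /andP[x0 x1]; apply: df0; rewrite !ltW.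
  - apply: continuous_in_subspaceT => x; rewrite inE/= in_itv/= => /df0; exact: derive_continuous.
  - by rewrite subrr !mul0r.
have cf0 x : -1 <= x <= 1 -> {for x, continuous f0} by move=> /df0; exact: derive_continuous.
have cf1 x : -1 <= x <= 1 -> {for x, continuous f1} by move=> /df1; exact: derive_continuous.
pose W := weak_integrand f0 f1 f2.
have cW x : -1 <= x <= 1 -> {for x, continuous W}.
  by move=> x1; apply: continuous_weak_integrand; [exact: cf0|exact: cf1|exact: cf2].
pose q0 x := f0 x - f0 (- x).
pose q1 x := f1 x + f1 (- x).
pose q2 x := f2 x - f2 (- x).
have dN x : is_derive x 1 (fun t : R => - t) (- 1) by exact: (derive_opp derive_var).
have dq0 x : 0 <= x <= 1 -> is_derive x 1 q0 ((l - 1) * q1 x).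
  move=> /andP[x0 x1]; apply: is_derive_eq.
    apply: (derive_add (df0 x _) (derive_opp (derive_comp (df0 (- x) _) (dN x)))); lra.
  by rewrite /q1; ring.
have dq1 x : 0 <= x <= 1 -> is_derive x 1 q1 (l * q2 x).
  move=> /andP[x0 x1]; apply: is_derive_eq.
    apply: (derive_add (df1 x _) (derive_comp (df1 (- x) _) (dN x))); lra.
  by rewrite /q2; ring.
have cq2 x : 0 <= x <= 1 -> {for x, continuous q2}.
  move=> /andP[x0 x1]; apply: cvgB; first by apply: cf2; lra.
  apply: (@continuous_comp _ _ _ (@GRing.opp R) f2); first exact: opp_continuous.
  by apply: cf2; lra.
(* By the mean value theorem on [[-x, x]]. *)
have [C C0 q0C] : exists2 C, 0 <= C & forall x, 0 <= x <= 1 -> `|q0 x| <= C * x.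
  have [|M M0 Mf1] := @bounded_on_segment f1 (-1) 1 _ cf1; first lra.
  exists (2 * (l - 1) * M) => [|x /andP[x0 x1]]; first by rewrite !mulr_ge0//; lra.
  rewrite /q0; have [|y| |y yx ->] := @MVT_segment R f0 (fun x => (l - 1) * f1 x) (- x) x.
  - by lra.
  - by rewrite in_itv/= => yx; apply: df0; lra.
  - apply: continuous_in_subspaceT => y; rewrite inE/= in_itv/= => yx.
    by apply: cf0; lra.
  - move: yx; rewrite in_itv/= => yx; rewrite !normrM.
    have -> : `|l - 1| = l - 1 by rewrite ger0_norm; lra.
    have -> : `|x - - x| = 2 * x by rewrite ger0_norm; lra.
    have h : `|f1 y| <= M by apply: Mf1; lra.
    rewrite (_ : 2 * (l - 1) * M * x = (l - 1) * M * (2 * x)); last by ring.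
    by rewrite ler_wpM2r// ?ler_wpM2l//; lra.
pose S n x := \sum_(k < n) density_term l k x.
have cT k x : {for x, continuous (density_term l k)} by exact: continuous_density_term.
have cS n x : {for x, continuous (S n)}.
  elim: n => [|n ih].
    rewrite (_ : S 0%N = cst 0); first exact: cvg_cst.
    by apply/funext => t; rewrite /S big_ord0.
  rewrite (_ : S n.+1 = fun t => S n t + density_term l n t); last first.
    by apply/funext => t; rewrite /S big_ord_recr.
  by apply: cvgD; [exact: ih|exact: cT].
have iT k : mu.-integrable `[-1, 1] (EFin \o (fun x => W x * density_term l k x)).
  by apply: integrable_continuous => x x1; apply: cvgM; [exact: cW|exact: cT].
have ST n : \int[mu]_(x in `[-1, 1]) (W x * S n.+1 x) =
    l * (l - 1) / 2 * \sum_(k < n.+1) gauss_coef l k *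
      \int[mu]_(x in `[0, 1]) (weak_integrand q0 q1 q2 x * radial l k x).
  have WT k : \int[mu]_(x in `[-1, 1]) (W x * density_term l k x) =
      l * (l - 1) / 2 * (gauss_coef l k *
      \int[mu]_(x in `[0, 1]) (weak_integrand q0 q1 q2 x * radial l k x)).
    rewrite Rintegral_fold; last first.
      by move=> x x1; apply: cvgM; [exact: cW|exact: cT].
    rewrite mulrA -RintegralZl//; last first.
      apply: integrable_continuous => x x01; apply: cvgM; last exact: continuous_radial.
      apply: continuous_weak_integrand.
      - exact: derive_continuous (dq0 x x01).
      - exact: derive_continuous (dq1 x x01).
      - exact: cq2.
    apply: eq_Rintegral => x _.
    rewrite /W /weak_integrand /density_term /radial normrN sqrrN /q0 /q1 /q2; ring.
  elim: n => [|n ih].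
    by rewrite big_ord1 -WT; apply: eq_Rintegral => x _; rewrite /S big_ord1.
  rewrite big_ord_recr/= mulrDr -ih -WT -RintegralD//.
    by apply: eq_Rintegral => x _; rewrite /S [in LHS]big_ord_recr/= mulrDr.
  apply: integrable_continuous => x x1; apply: cvgM; first exact: cW.
  exact: cS.
have lim1 : (fun n => \int[mu]_(x in `[-1, 1]) (W x * S n.+1 x)) @ \oo --> q0 1.
  under eq_fun do rewrite ST mulrAC.
  rewrite -[q0 1](mulfK (_ : 2 != 0 :> R))// [q0 1 * 2]mulrC.
  apply: cvgM; last exact: cvg_cst.
  exact: (sum_radial_by_parts_cvg l1 dq0 dq1 cq2 q0C).
have [M M0 WM] : exists2 M, 0 <= M & forall x, -1 <= x <= 1 -> `|W x| <= M.
  by apply: bounded_on_segment => //; lra.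
have S0 n x : -1 <= x <= 1 -> 0 <= S n x.
  by move=> x1; apply: sumr_ge0 => k _; exact: density_term_ge0.
have SE n x : (S n x)%:E = (\sum_(0 <= k < n) (density_term l k x)%:E)%E.
  by rewrite sumEFin big_mkord.
have Sle n x : -1 <= x <= 1 -> ((S n x)%:E <= density_series l x)%E.
  move=> x1; rewrite SE; apply: nneseries_lim_ge => k _ _.
  by rewrite lee_fin density_term_ge0.
have mW (f : R -> R) : (forall x, -1 <= x <= 1 -> {for x, continuous f}) ->
    measurable_fun (`[-1, 1] : set (measurableTypeR R)) f.
  move=> cf; apply/measurable_EFinP.
  by case/integrableP : (integrable_continuous cf).
have mWS n : measurable_fun (`[-1, 1] : set (measurableTypeR R)) (fun x => (W x * S n.+1 x)%:E).
  by apply/measurable_EFinP; apply: mW => x x1; apply: cvgM; [exact: cW|exact: cS].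
have mWh : measurable_fun (`[-1, 1] : set (measurableTypeR R)) (fun x => (W x * h_density l x)%:E).
  apply/measurable_EFinP; apply: measurable_funM; first exact: mW.
  by apply: measurable_funTS; exact: (measurable_h_density (ltW l1)).
have ae_cvg : {ae mu, forall x, `[-1, 1]%classic x ->
    (W x * S n.+1 x)%:E @[n --> \oo] --> (W x * h_density l x)%:E}.
  have mD : measurable (`[-1, 1] : set (measurableTypeR R)) by exact: measurable_itv.
  have := integrable_ae mD (integrable_density_series l1).
  apply: filterS => x /= /[swap] x1 /(_ x1) fG; move: x1; rewrite in_itv/= => x1.
  apply: cvg_EFin; first exact: nearW.
  apply: cvgM; first exact: cvg_cst.
  rewrite h_densityE//; have : (fun n => (S n x)%:E) @ \oo --> (fine (density_series l x))%:E.
    rewrite fineK//; under eq_fun do rewrite SE.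
    apply: is_cvg_nneseries => k _ _; rewrite lee_fin; exact: density_term_ge0.
  by move=> /fine_cvgP[_]; rewrite -cvg_shiftS.
have [|||||iWh _ lim2] := @dominated_convergence _ _ _ mu `[-1, 1] (measurable_itv _)
  (fun n x => (W x * S n.+1 x)%:E) (fun x => (W x * h_density l x)%:E)
  (fun x => M%:E * density_series l x)%E.
- exact: mWS.
- exact: mWh.
- exact: ae_cvg.
- by apply: integrableZl => //; exact: integrable_density_series.
- apply: aeW => x n /=; rewrite in_itv/= => x1.
  rewrite normrM EFinM; apply: lee_pmul => //; first exact: WM.
  by rewrite ger0_norm ?S0//; exact: Sle.
have lim3 : (fun n => \int[mu]_(x in `[-1, 1]) (W x * S n.+1 x)) @ \oo -->
    \int[mu]_(x in `[-1, 1]) (W x * h_density l x).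
  apply: fine_cvg; rewrite /Rintegral fineK; first exact: lim2.
  exact: integrable_fin_num iWh.
rewrite -[RHS]/(q0 1); apply/esym; exact: (cvg_unique _ lim1 lim3).
Qed.

End density.

(** * Integration against null sets and densities *)
Section null_complement.
Local Open Scope ereal_scope.
Context d (T : measurableType d) (R : realType).
Variables (m : {measure set T -> \bar R}) (D : set T).
Hypotheses (mD : measurable D) (mCD : m (~` D) = 0).

Import HBNNSimple.

Let ge0_integral_null_compl (f : T -> \bar R) : (forall x, 0 <= f x) ->
  \int[m]_x f x = \int[m]_(x in D) f x.
Proof.
move=> f0; have fD0 x : 0 <= (f \_ D) x by rewrite patchE; case: ifP.
rewrite [RHS]integral_mkcond; apply/eqP; rewrite eq_le; apply/andP; split; last first.
  rewrite !ge0_integralTE//; apply: ge_ereal_sup => _ [h /= hf <-].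
  apply: ereal_sup_ubound; exists h => //= x; apply: (le_trans (hf x)).
  by rewrite patchE; case: ifP.
rewrite [leLHS]ge0_integralTE//; apply: ge_ereal_sup => _ [h /= hf <-].
rewrite -integral_mkcond; have -> : sintegral m h = \int[m]_x (h x)%:E.
  by rewrite integral_nnsfun// patch_setT.
rewrite (@ge0_negligible_integral _ _ _ m setT (~` D))//; last 3 first.
- exact: measurableC.
- exact/measurable_EFinP.
- by move=> x _; rewrite lee_fin.
rewrite setTD setCK.
have -> : \int[m]_(x in D) f x = \int[m]_x ((f \_ D) x) by rewrite -integral_mkcond.
rewrite integral_nnsfun// ge0_integralTE//; apply: ereal_sup_ubound.
exists (proj_nnsfun h mD); last by rewrite -(mrestrict h mD).
move=> x; rewrite -(mrestrict h mD) !patchE; case: ifP => // _; exact: hf.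
Qed.

(** The integrand is arbitrary because, off the interval that carries the measure, the power in
the Stieltjes transform crosses its cut. *)
Lemma integral_null_compl (f : T -> \bar R) :
  \int[m]_x f x = \int[m]_(x in D) f x.
Proof. by rewrite integralE [RHS]integralE !ge0_integral_null_compl. Qed.

End null_complement.

Section density_integral.
Local Open Scope ereal_scope.
Context d (T : measurableType d) (R : realType).
Variables (m : {measure set T -> \bar R}) (g : T -> R).
Hypotheses (mg : measurable_fun setT g) (g0 : forall x, (0 <= g x)%R).
Notation nu := (density_measure m mg g0).
Variables (D : set T) (mD : measurable D).

Import HBNNSimple.

Let integral_density_indic E : measurable E ->
  \int[nu]_(x in D) (\1_E x)%:E = \int[m]_(x in D) ((\1_E x)%:E * (g x)%:E).
Proof.
move=> mE; transitivity (\int[m]_(x in D `&` E) (g x)%:E).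
  by rewrite integral_indic// setIC.
rewrite integral_mkcondr.
apply: eq_integral => x _; rewrite patchE indicE.
by case: (x \in E); rewrite ?mul1e ?mul0e.
Qed.

Let integral_density_nnsfun (h : {nnsfun T >-> R}) :
  \int[nu]_(x in D) (h x)%:E = \int[m]_(x in D) ((h x)%:E * (g x)%:E).
Proof.
under [LHS]eq_integral do rewrite fimfunE -fsumEFin//.
rewrite [LHS]ge0_integral_fsum//; last 2 first.
  - by move=> r; exact/measurable_EFinP/measurableT_comp.
  - by move=> n x _; rewrite EFinM nnfun_muleindic_ge0.
under [RHS]eq_integral.
  move=> x xD; rewrite fimfunE -fsumEFin// muleC ge0_mule_fsumr; last first.
    by move=> r; rewrite EFinM nnfun_muleindic_ge0.
  over.
rewrite [RHS]ge0_integral_fsum//; last 2 first.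
  - move=> r; apply/measurable_EFinP/measurable_funM; first exact: measurable_funTS.
    exact/measurableT_comp.
  - by move=> n x _; apply: mule_ge0; [rewrite lee_fin|rewrite EFinM nnfun_muleindic_ge0].
apply: eq_fsbigr => r _; rewrite integralZl_indic_nnsfun//=.
have [r0|r0] := leP 0%R r; last first.
  by rewrite preimage_nnfun0// integral_indic// set0I measure0 mule0
    integral0_eq// => x _; rewrite indic0 mulr0 mule0.
rewrite integral_density_indic// -ge0_integralZl//.
- by apply: eq_integral => x _; rewrite EFinM muleA muleC.
- apply/measurable_EFinP/measurable_funM; last exact: measurable_funTS.
  exact: measurable_indic.
- by move=> x _; rewrite mule_ge0 ?lee_fin.
Qed.

Lemma ge0_integral_density (f : T -> \bar R) : measurable_fun D f ->
  (forall x, D x -> 0 <= f x) ->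
  \int[nu]_(x in D) f x = \int[m]_(x in D) (f x * (g x)%:E).
Proof.
move=> mf f0; pose f_ := nnsfun_approx mD mf.
have fcvg x : D x -> (f_ n x)%:E @[n --> \oo] --> f x by exact: cvg_nnsfun_approx.
transitivity (limn (fun n => \int[nu]_(x in D) (f_ n x)%:E)).
  rewrite -monotone_convergence//=.
  - by apply: eq_integral => x /[!inE] xD; apply/esym/cvg_lim => //; exact: fcvg.
  - by move=> n; exact/measurable_EFinP/measurable_funTS.
  - by move=> n x _; rewrite lee_fin.
  - by move=> x _ a b ab; rewrite lee_fin; exact/lefP/nd_nnsfun_approx.
under eq_fun do rewrite integral_density_nnsfun.
rewrite -monotone_convergence//=.
- apply: eq_integral => x /[!inE] xD; apply/cvg_lim => //.
  by apply: cvgeZr => //; exact: fcvg.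
- move=> n; apply/measurable_EFinP/measurable_funM; first exact: measurable_funTS.
  exact: measurable_funTS.
- by move=> n x _; rewrite mule_ge0 ?lee_fin.
- move=> x _ a b ab; rewrite lee_wpmul2r ?lee_fin//; exact/lefP/nd_nnsfun_approx.
Qed.

Lemma integral_density (f : T -> R) : measurable_fun D f ->
  \int[nu]_(x in D) (f x)%:E = \int[m]_(x in D) (f x * g x)%:E.
Proof.
move=> mf; have mfE : measurable_fun D (EFin \o f) by exact/measurable_EFinP.
rewrite [LHS]integralE [RHS]integralE; congr (_ - _).
- rewrite ge0_integral_density; last 2 first.
  + exact: measurable_funepos.
  + by move=> x _; exact: funepos_ge0.
  apply: eq_integral => x _; rewrite !funeposE/= -!EFin_max -EFinM.
  by rewrite maxr_pMl// mul0r.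
- rewrite ge0_integral_density; last 2 first.
  + exact: measurable_funeneg.
  + by move=> x _; exact: funeneg_ge0.
  apply: eq_integral => x _; rewrite !funenegE/= -!EFin_max -EFinM.
  by rewrite maxr_pMl// mul0r mulNr.
Qed.

End density_integral.

(** * Integration against the measure *)
Section integral_mscale.
Local Open Scope ereal_scope.
Context d (T : measurableType d) (R : realType).
Variables (m : {measure set T -> \bar R}) (k : {nonneg R}) (D : set T).
Hypothesis mD : measurable D.

Lemma integral_mscale (f : T -> \bar R) : m.-integrable D f ->
  \int[mscale k m]_(x in D) f x = k%:num%:E * \int[m]_(x in D) f x.
Proof.
move=> intf; have /integrableP[mf _] := intf.
have mp := measurable_funepos mf; have mn := measurable_funeneg mf.
rewrite [LHS]integralE (ge0_integral_mscale m mD k mp)// (ge0_integral_mscale m mD k mn)//.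
rewrite [in RHS](integralE m D f) [RHS]muleBr//.
by rewrite fin_num_adde_defl// fin_numN (integrable_neg_fin_num mD intf).
Qed.

Lemma integrable_mscale (f : T -> \bar R) : m.-integrable D f ->
  (mscale k m).-integrable D f.
Proof.
move=> /integrableP[mf ltf]; apply/integrableP; split => //.
rewrite ge0_integral_mscale//; last exact: measurableT_comp.
by rewrite lte_mul_pinfty// lee_fin.
Qed.

Lemma integrable_measure_add (m' : {measure set T -> \bar R}) (f : T -> \bar R) :
  m.-integrable D f -> m'.-integrable D f -> (measure_add m m').-integrable D f.
Proof.
move=> /integrableP[mf ltf] /integrableP[_ ltf']; apply/integrableP; split => //.
rewrite ge0_integral_measure_add//; last exact: measurableT_comp.
exact: lte_add_pinfty.
Qed.

End integral_mscale.

Section mu_l_facts.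
Context {R : realType}.
Notation leb := (@lebesgue_measure R).
Local Notation D := (`[-1, 1]%classic : set (measurableTypeR R)).
Implicit Types (l : R) (f : R -> R).

Let mD : measurable D.
Proof. exact: measurable_itv. Qed.

Lemma measurable_continuous f : (forall x, -1 <= x <= 1 -> {for x, continuous f}) ->
  measurable_fun D f.
Proof.
move=> cf; apply/measurable_EFinP.
by case/integrableP : (integrable_continuous cf).
Qed.

Lemma in_DE (x : R) : (x \in D) = (-1 <= x <= 1).
Proof. by apply/idP/idP; rewrite inE/= in_itv. Qed.

Lemma integrable_dirac (a : R) f : measurable_fun D f ->
  (@dirac _ (measurableTypeR R) a R).-integrable D (EFin \o f).
Proof.
move=> mf; apply/integrableP; split; first exact/measurable_EFinP.
rewrite integral_dirac//; last exact/measurable_EFinP/measurableT_comp.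
by rewrite diracE/=; case: (_ \in _); rewrite ?mul1e ?mul0e ltry.
Qed.

Lemma integrable_h_measure l (l1 : 1 <= l) f :
  (forall x, -1 <= x <= 1 -> {for x, continuous f}) ->
  (h_measure l1).-integrable D (EFin \o f).
Proof.
move=> cf; have mf := measurable_continuous cf.
have [|M M0 fM] := @bounded_on_segment R f (-1) 1 _ cf; first by lra.
apply/integrableP; split; first exact/measurable_EFinP.
rewrite ge0_integral_density//; last first.
  by apply: measurableT_comp => //; exact/measurable_EFinP.
have /integrableP[_] : leb.-integrable D (fun x => M%:E * (h_density l x)%:E)%E.
  by apply: integrableZl => //; exact: integrable_h_density.
apply: le_lt_trans; apply: ge0_le_integral => //.
- by move=> x _; rewrite mule_ge0// lee_fin h_density_ge0.
- apply: emeasurable_funM.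
    by apply: measurableT_comp => //; exact/measurable_EFinP.
  by apply/measurable_EFinP; apply: measurable_funTS; exact: measurable_h_density.
- apply: measurableT_comp => //; apply: emeasurable_funM => //.
  by apply/measurable_EFinP; apply: measurable_funTS; exact: measurable_h_density.
- move=> x /=; rewrite in_itv/= => x1.
  rewrite -!EFinM lee_fin normrM (ger0_norm M0) (ger0_norm (h_density_ge0 l1 x)).
  by apply: ler_wpM2r; [exact: h_density_ge0|exact: fM].
Qed.

Lemma integrable_mu_l l (l1 : 1 <= l) f :
  (forall x, -1 <= x <= 1 -> {for x, continuous f}) ->
  (mu_l l1).-integrable D (EFin \o f).
Proof.
move=> cf; have mf := measurable_continuous cf.
apply: integrable_mscale => //; apply: integrable_measure_add => //.
  by apply: integrable_measure_add => //; exact: integrable_dirac.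
exact: integrable_h_measure.
Qed.

Lemma Rintegral_mu_l l (l1 : 1 <= l) f :
  (forall x, -1 <= x <= 1 -> {for x, continuous f}) ->
  \int[mu_l l1]_(x in D) f x =
  (2 `^ l)^-1 * (f 1 + f (-1) + \int[leb]_(x in D) (f x * h_density l x)).
Proof.
move=> cf; have mf := measurable_continuous cf.
have mfE : measurable_fun D (EFin \o f) by exact/measurable_EFinP.
have ih := integrable_h_measure l1 cf.
have i2 : (measure_add (@dirac _ (measurableTypeR R) 1 R)
    (@dirac _ (measurableTypeR R) (-1) R)).-integrable D (EFin \o f).
  by apply: integrable_measure_add => //; exact: integrable_dirac.
have D1 : @dirac _ (measurableTypeR R) 1 R D = 1%E.
  by rewrite diracE mem_set//= in_itv/= lexx ?andbT/= ge0_cp.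
have DN1 : @dirac _ (measurableTypeR R) (-1) R D = 1%E.
  by rewrite diracE mem_set//= in_itv/= lexx ?andbT/= ge0_cp.
rewrite /Rintegral integral_mscale//; last exact: integrable_measure_add.
rewrite (integral_measure_add mD i2 ih)// (integral_measure_add mD)//; last 2 first.
- exact: integrable_dirac.
- exact: integrable_dirac.
rewrite !integral_dirac// D1 DN1 !mul1e integral_density//.
have fh : (\int[leb]_(x in D) (f x * h_density l x)%:E)%E \is a fin_num.
  rewrite -(integral_density leb (measurable_h_density l1) (h_density_ge0 l1))//.
  exact: integrable_fin_num ih.
by rewrite fine_mull fineD// fineD.
Qed.

Lemma mu_l_weak l (l1 : 1 <= l) (f0 f1 f2 : R -> R) :
  (forall x : R, -1 <= x <= 1 -> is_derive x 1 f0 ((l - 1) * f1 x)) ->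
  (forall x : R, -1 <= x <= 1 -> is_derive x 1 f1 (l * f2 x)) ->
  (forall x : R, -1 <= x <= 1 -> {for x, continuous f2}) ->
  \int[mu_l l1]_(x in D) weak_integrand f0 f1 f2 x = 0.
Proof.
move=> df0 df1 cf2; rewrite Rintegral_mu_l; last first.
  move=> x x1; apply: continuous_weak_integrand; last exact: cf2.
  - exact: derive_continuous (df0 x x1).
  - exact: derive_continuous (df1 x x1).
by rewrite h_density_weak// /weak_integrand; ring.
Qed.

Let D_1 : D 1.
Proof. by rewrite /= in_itv/= lexx andbT ge0_cp. Qed.

Let D_N1 : D (-1).
Proof. by rewrite /= in_itv/= lexx ge0_cp. Qed.

Lemma h_density_eq0 l (x : R) : ~ D x -> h_density l x = 0.
Proof.
move=> Dx; rewrite /h_density /hfun indicE memNset ?mulr0//=.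
rewrite in_itv/= sqr_ge0/= => x1; apply: Dx; rewrite /= in_itv/=.
by apply/andP; split; nra.
Qed.

Lemma mu_l_compl l (l1 : 1 <= l) : mu_l l1 (~` D) = 0%E.
Proof.
rewrite mu_lE !diracE memNset; last by move=> /(_ D_1).
rewrite memNset; last by move=> /(_ D_N1).
rewrite integral0_eq ?adde0 ?mule0//.
by move=> x /= Dx; rewrite h_density_eq0.
Qed.

Lemma mu_l_lty l (l1 : 1 <= l) : (mu_l l1 D < +oo)%E.
Proof.
have /integrableP[_] : (mu_l l1).-integrable D (EFin \o cst 1).
  by apply: integrable_mu_l => x _; exact: cvg_cst.
under eq_integral do rewrite /= normr1.
by rewrite integral_cst// mul1e.
Qed.

Lemma mu_l_setT l (l1 : 1 <= l) : mu_l l1 [set: R] = mu_l l1 D.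
Proof.
rewrite -(setUv D); apply: (eq_trans (measureU _ mD (measurableC mD) _)).
  by rewrite setICr.
rewrite -[RHS]adde0; congr (_ + _)%E; exact: mu_l_compl.
Qed.

Lemma mu_l_set1 l (l1 : 1 <= l) : mu_l l1 [set 1] = ((2 `^ l)^-1)%:E.
Proof.
rewrite mu_lE !diracE mem_set// memNset; last by move=> /= h; have := @ltr01 R; rewrite -h; lra.
by rewrite integral_set1 !adde0 mule1.
Qed.

Lemma support_mu_l l (l1 : 1 <= l) : Defs.support (mu_l l1) 1.
Proof.
move=> U oU U1; suff h : (0 < mu_l l1 U)%E by rewrite gt_eqF.
have : (0 < mu_l l1 [set 1%R])%E by rewrite mu_l_set1 lte_fin invr_gt0 powR_gt0.
move=> /lt_le_trans; apply; apply: le_measure; rewrite ?inE//.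
- exact: open_measurable.
- by move=> x ->.
Qed.

Lemma Rintegral_mu_l_setT l (l1 : 1 <= l) f :
  \int[mu_l l1]_x f x = \int[mu_l l1]_(x in D) f x.
Proof. by rewrite /Rintegral (integral_null_compl mD (mu_l_compl l1)). Qed.

Lemma Rintegral_sym_bernoulli f : (forall x : R, -1 <= x <= 1 -> {for x, continuous f}) ->
  \int[@sym_bernoulli R]_x f x = (f 1 + f (-1)) / 2.
Proof.
move=> cf; have mf := measurable_continuous cf.
have mfE : measurable_fun D (EFin \o f) by exact/measurable_EFinP.
have D1 : @dirac _ (measurableTypeR R) 1 R D = 1%E by rewrite diracE mem_set.
have DN1 : @dirac _ (measurableTypeR R) (-1) R D = 1%E by rewrite diracE mem_set.
have C0 : @sym_bernoulli R (~` D) = 0%E.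
  rewrite sym_bernoulliE !diracE memNset; last by move=> /(_ D_N1).
  by rewrite memNset ?adde0 ?mule0//; move=> /(_ D_1).
rewrite /Rintegral (integral_null_compl mD C0) integral_mscale//; last first.
  by apply: integrable_measure_add => //; exact: integrable_dirac.
rewrite (integral_measure_add mD)//; [|exact: integrable_dirac..].
by rewrite !integral_dirac// D1 DN1 !mul1e fine_mull fineD//=; field.
Qed.

End mu_l_facts.

(** * Real and imaginary parts, modulus and argument *)
Section complex_components.
Context {R : realType}.
Implicit Types (z w : R[i]) (a r s : R) (f g : R -> R[i]).
Notation Re := complex.Re.
Notation Im := complex.Im.
Notation normc := Normc.normc.

Lemma eq_complexP z w : Re z = Re w -> Im z = Im w -> z = w.
Proof. by case: z => ? ?; case: w => ? ? /= -> ->. Qed.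

Lemma cReM z w : Re (z * w) = Re z * Re w - Im z * Im w.
Proof. by case: z; case: w. Qed.

Lemma cImM z w : Im (z * w) = Re z * Im w + Im z * Re w.
Proof. by case: z => ? ?; case: w. Qed.

Lemma cReD z w : Re (z + w) = Re z + Re w.
Proof. by case: z; case: w. Qed.

Lemma cImD z w : Im (z + w) = Im z + Im w.
Proof. by case: z => ? ?; case: w. Qed.

Lemma cReN z : Re (- z) = - Re z.
Proof. by case: z. Qed.

Lemma cImN z : Im (- z) = - Im z.
Proof. by case: z. Qed.

Lemma normc_sqrtE z : normc z = Num.sqrt (Re z ^+ 2 + Im z ^+ 2).
Proof. by case: z. Qed.

Lemma normc_ge0 z : 0 <= normc z.
Proof. by rewrite normc_sqrtE sqrtr_ge0. Qed.

Lemma normc_sqr z : normc z ^+ 2 = Re z ^+ 2 + Im z ^+ 2.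
Proof. by rewrite normc_sqrtE sqr_sqrtr// addr_ge0 ?sqr_ge0. Qed.

Lemma normc_gt0 z : (0 < normc z) = (z != 0).
Proof.
rewrite lt_neqAle normc_ge0 andbT eq_sym; congr (~~ _); apply/eqP/eqP.
  exact: Normc.eq0_normc.
by move=> ->; rewrite Normc.normc0.
Qed.

Lemma cReV z : Re z^-1 = Re z / normc z ^+ 2.
Proof. by rewrite normc_sqr; case: z. Qed.

Lemma cImV z : Im z^-1 = - Im z / normc z ^+ 2.
Proof. by rewrite normc_sqr; case: z => ? ? /=; rewrite mulNr. Qed.

Lemma normRe_le z : `|Re z| <= normc z.
Proof.
by rewrite -sqrtr_sqr normc_sqrtE ler_wsqrtr// lerDl sqr_ge0.
Qed.

Lemma normIm_le z : `|Im z| <= normc z.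
Proof.
by rewrite -sqrtr_sqr normc_sqrtE ler_wsqrtr// lerDr sqr_ge0.
Qed.

(** An inequality between continuous functions, hence an open condition. *)
Lemma slit_planeP z : slit_plane z <-> 0 < normc z + Re z.
Proof.
split=> [zs|z0 [Rez Imz]].
  have := normRe_le z; rewrite ler_norml => /andP[lez _].
  have p : 0 <= normc z + Re z by lra.
  rewrite lt_neqAle p andbT eq_sym.
  apply/eqP => h; apply: zs; have nR : normc z = - Re z by lra.
  split; first by have := normc_ge0 z; lra.
  have := normc_sqr z; rewrite nR sqrrN => /eqP; rewrite -subr_eq0 opprD addrA subrr sub0r oppr_eq0.
  by rewrite sqrf_eq0 => /eqP.
by move: z0; rewrite normc_sqrtE Imz expr0n addr0 sqrtr_sqr ler0_norm// addNr ltxx.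
Qed.

Lemma slit_plane_neq0 z : slit_plane z -> z != 0.
Proof. by move=> zs; apply/eqP => z0; apply: zs; rewrite z0. Qed.

(** Half of the argument is the argument of [normc z + z]; this formula is smooth on the whole
slit plane, whereas the one through [acos] is not smooth on the real axis. *)
Lemma Carg_atan z : slit_plane z -> Carg z = 2 * atan (Im z / (normc z + Re z)).
Proof.
move=> zs; have n0 : 0 < normc z by rewrite normc_gt0 slit_plane_neq0.
have m0 := (slit_planeP z).1 zs.
set m := _ + _ in m0 *; set t := Im z / m.
have t1 : 1 + t ^+ 2 = 2 * normc z / m.
  rewrite /t expr_div_n; apply: (mulIf (lt0r_neq0 m0)); apply: (mulIf (lt0r_neq0 m0)).
  have -> : (1 + Im z ^+ 2 / m ^+ 2) * m * m = m ^+ 2 + Im z ^+ 2 by field; rewrite gt_eqF.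
  have -> : 2 * normc z / m * m * m = 2 * normc z * m by field; rewrite gt_eqF.
  rewrite {1}/m sqrrD; have -> : Im z ^+ 2 = normc z ^+ 2 - Re z ^+ 2.
    by rewrite normc_sqr; ring.
  by rewrite /m; ring.
have c2 : cos (2 * atan t) = Re z / normc z.
  rewrite mulrC mulr_natr cos_mulr2n cos_atan exprVn sqr_sqrtr; last first.
    by rewrite addr_ge0 ?sqr_ge0.
  by rewrite t1 /m; field; rewrite !gt_eqF.
have a1 := atan_gtNpi2 t; have a2 := atan_ltpi2 t.
have pi0 := @pi_gt0 R.
rewrite /Carg -c2; case: ifP => [Im0|/negbT Im0].
- rewrite cosK//; rewrite in_itv/=; apply/andP; split; last by lra.
  rewrite mulr_ge0//; rewrite -atan0; apply: le_atan.
  by rewrite divr_ge0// ltW.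
- rewrite cosKN; first by rewrite opprK.
  apply/andP; split; first by lra.
  rewrite pmulr_rle0// -atan0; apply: le_atan.
  by rewrite pmulr_lle0 ?invr_gt0// ltW// ltNge.
Qed.

Lemma Re_Carg z : z != 0 -> normc z * cos (Carg z) = Re z.
Proof.
rewrite -normc_gt0 => n0; have := normRe_le z; rewrite ler_norml => /andP[h1 h2].
have h : -1 <= Re z / normc z <= 1.
  by rewrite ler_pdivlMr// ler_pdivrMr// mulN1r mul1r h1.
rewrite /Carg; case: ifP => _; rewrite ?cosN acosK ?in_itv//=; field; by rewrite gt_eqF.
Qed.

Lemma Im_Carg z : z != 0 -> normc z * sin (Carg z) = Im z.
Proof.
rewrite -normc_gt0 => n0; have := normRe_le z; rewrite ler_norml => /andP[h1 h2].
have h : -1 <= Re z / normc z <= 1.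
  by rewrite ler_pdivlMr// ler_pdivrMr// mulN1r mul1r h1.
have hs : normc z * sin (acos (Re z / normc z)) = `|Im z|.
  rewrite sin_acos// -{1}[normc z]ger0_norm ?normc_ge0// -{1}sqrtr_sqr -sqrtrM ?sqr_ge0//.
  rewrite -sqrtr_sqr; congr Num.sqrt; rewrite expr_div_n mulrBr mulr1 mulrC divfK.
    by rewrite normc_sqr; ring.
  by rewrite expf_neq0// gt_eqF.
rewrite /Carg; case: ifP => [Im0|/negbT Im0]; rewrite ?sinN ?mulrN hs.
  by rewrite ger0_norm.
by rewrite ler0_norm ?opprK// ltW// ltNge.
Qed.

End complex_components.

(** * Complex valued functions of a real variable *)
Section complex_derivative.
Context {R : realType}.
Implicit Types (z w : R[i]) (a r s : R) (f g : R -> R[i]).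
Notation Re := complex.Re.
Notation Im := complex.Im.
Notation normc := Normc.normc.

(** Componentwise, the variable being real and the values complex. *)
Definition is_cderive f s (d : R[i]) :=
  is_derive s 1 (fun t => Re (f t)) (Re d) /\ is_derive s 1 (fun t => Im (f t)) (Im d).

Lemma cderive_eq f s d d' : is_cderive f s d -> d = d' -> is_cderive f s d'.
Proof. by move=> h <-. Qed.

Lemma cderive_mul f g s df dg : is_cderive f s df -> is_cderive g s dg ->
  is_cderive (fun t => f t * g t) s (df * g s + f s * dg).
Proof.
move=> [fR fI] [gR gI]; split.
- under eq_fun do rewrite cReM.
  apply: (is_derive_eq (derive_add (derive_mul fR gR) (derive_opp (derive_mul fI gI)))).
  by rewrite cReD !cReM; ring.
- under eq_fun do rewrite cImM.
  apply: (is_derive_eq (derive_add (derive_mul fR gI) (derive_mul fI gR))).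
  by rewrite cImD !cImM; ring.
Qed.

Lemma cderive_add f g s df dg : is_cderive f s df -> is_cderive g s dg ->
  is_cderive (fun t => f t + g t) s (df + dg).
Proof.
move=> [fR fI] [gR gI]; split.
- by under eq_fun do rewrite cReD; rewrite cReD; exact: derive_add.
- by under eq_fun do rewrite cImD; rewrite cImD; exact: derive_add.
Qed.

Lemma cderive_const s z : is_cderive (fun=> z) s 0.
Proof. by split; exact: derive_const. Qed.

Lemma cderive_real s : is_cderive (real_complex R) s 1.
Proof. by split; [exact: derive_var|exact: derive_const]. Qed.

Lemma derive_sqr_normc f s df : is_cderive f s df ->
  is_derive s 1 (fun t => normc (f t) ^+ 2) (2 * (Re (f s) * Re df + Im (f s) * Im df)).
Proof.
move=> [fR fI]; under eq_fun do rewrite normc_sqr.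
apply: (is_derive_eq (derive_add (derive_expn 2 fR) (derive_expn 2 fI))).
by rewrite /= !expr1; ring.
Qed.

Lemma derive_normc f s df : f s != 0 -> is_cderive f s df ->
  is_derive s 1 (fun t => normc (f t))
    ((Re (f s) * Re df + Im (f s) * Im df) / normc (f s)).
Proof.
rewrite -normc_gt0 => n0 hf.
have -> : (fun t => normc (f t)) = (fun t => Num.sqrt (normc (f t) ^+ 2)).
  by apply/funext => t; rewrite sqrtr_sqr ger0_norm ?normc_ge0.
apply: (is_derive_eq (derive_comp (g := fun t => normc (f t) ^+ 2)
  (is_derive1_sqrt (exprn_gt0 2 n0)) (derive_sqr_normc hf))).
by rewrite sqrtr_sqr ger0_norm ?ltW//; field; rewrite gt_eqF.
Qed.

Lemma cderive_inv f s df : f s != 0 -> is_cderive f s df ->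
  is_cderive (fun t => (f t)^-1) s (- df / f s ^+ 2).
Proof.
move=> f0 hf; have [fR fI] := hf; have dn := derive_sqr_normc hf.
have n0 : normc (f s) ^+ 2 != 0 by rewrite expf_neq0// gt_eqF// normc_gt0.
have n1 : normc (f s) != 0 by rewrite gt_eqF// normc_gt0.
have e : normc (f s) ^+ 2 = Re (f s) ^+ 2 + Im (f s) ^+ 2 by exact: normc_sqr.
split.
- under eq_fun do rewrite cReV.
  apply: (is_derive_eq (derive_mul fR
    (derive_inv (f := fun t => normc (f t) ^+ 2) n0 dn))).
  rewrite expr2 cReM cReN cImN cReV cImV Normc.normcM cReM cImM.
  move: (normc _) (Re (f s)) (Im (f s)) n1 e => n x y n1 e.
  by field: e.
- under eq_fun do rewrite cImV.
  apply: (is_derive_eq (derive_mul (derive_opp fI)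
    (derive_inv (f := fun t => normc (f t) ^+ 2) n0 dn))).
  rewrite expr2 cImM cReN cImN cReV cImV Normc.normcM cReM cImM.
  move: (normc _) (Re (f s)) (Im (f s)) n1 e => n x y n1 e.
  by field: e.
Qed.

Lemma cderive_continuous f s df : is_cderive f s df ->
  {for s, continuous (fun t => Re (f t))} /\ {for s, continuous (fun t => Im (f t))}.
Proof. by move=> [fR fI]; split; [exact: derive_continuous fR|exact: derive_continuous fI]. Qed.

Lemma slit_plane_near f s df : is_cderive f s df -> slit_plane (f s) ->
  \forall t \near s, slit_plane (f t).
Proof.
move=> hf fs; have [fR fI] := hf.
have c : {for s, continuous (fun t => normc (f t) + Re (f t))}.
  exact: (derive_continuous (derive_add (derive_normc (slit_plane_neq0 fs) hf) fR)).
have : \forall t \near s, 0 < normc (f t) + Re (f t).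
  by apply: (cvgr_gt _ c); exact/slit_planeP.
by apply: filterS => t /slit_planeP.
Qed.

(** Written with the logarithmic derivative, so that every power in a computation is the same
one. *)
Lemma cderive_Cpow a f s df : is_cderive f s df -> slit_plane (f s) ->
  is_cderive (fun t => Cpow (f t) a) s (real_complex R a * df / f s * Cpow (f s) a).
Proof.
move=> hf fs; have [fR fI] := hf; have f0 := slit_plane_neq0 fs.
have n0 : 0 < normc (f s) by rewrite normc_gt0.
have m0 := (slit_planeP _).1 fs.
have dn := derive_normc f0 hf.
set dn' := _ / _ in dn.
have dC : is_derive s 1 (fun t => Carg (f t))
    ((Re (f s) * Im df - Im (f s) * Re df) / normc (f s) ^+ 2).
  have : \forall t \near s, 2 * atan (Im (f t) / (normc (f t) + Re (f t))) = Carg (f t).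
    by have := slit_plane_near hf fs; apply: filterS => t ft; rewrite Carg_atan.
  move/near_eq_is_derive; apply.
  have dm := derive_inv (f := fun t => normc (f t) + Re (f t)) (lt0r_neq0 m0) (derive_add dn fR).
  have dt := derive_comp (g := fun t => Im (f t) / (normc (f t) + Re (f t)))
    (is_derive1_atan _) (derive_mul fI dm).
  apply: (is_derive_eq (derive_mul (derive_const 2) dt)).
  rewrite /dn'; have e := normc_sqr (f s).
  move: (normc _) (Re (f s)) (Im (f s)) n0 m0 e => n x y n0 m0 e.
  have n1 : n != 0 by exact: lt0r_neq0.
  have m1 : n + x != 0 by exact: lt0r_neq0.
  have -> : 1 + (y / (n + x)) ^+ 2 = 2 * n / (n + x).
    by field: e.
  by field: e; rewrite n1 m1.
have dP : is_derive s 1 (fun t => normc (f t) `^ a) (a * (normc (f s) `^ a / normc (f s)) * dn').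
  apply: (is_derive_eq (derive_comp (g := fun t => normc (f t)) (is_derive1_powR a n0) dn)).
  by rewrite powRB ?powRr1 ?ltW// lt0r_neq0// implybT.
split.
- have dc := derive_comp (g := fun t => a * Carg (f t)) (is_derive_cos _)
    (derive_mul (derive_const a) dC).
  apply: (is_derive_eq (derive_mul dP dc)).
  rewrite !cReM !cImM !cReM /= cReV cImV /dn'.
  by field; rewrite lt0r_neq0.
- have dc := derive_comp (g := fun t => a * Carg (f t)) (is_derive_sin _)
    (derive_mul (derive_const a) dC).
  apply: (is_derive_eq (derive_mul dP dc)).
  rewrite !cImM !cReM !cImM /= cReV cImV /dn'.
  by field; rewrite lt0r_neq0.
Qed.

End complex_derivative.

(** * The principal power on the slit plane *)
Section Cpow_algebra.
Context {R : realType}.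
Implicit Types (z w : R[i]) (a r s t : R).
Notation Re := complex.Re.
Notation Im := complex.Im.
Notation normc := Normc.normc.
Notation "x %:C" := (real_complex R x) : ring_scope.

Lemma normc_Cpow z a : normc (Cpow z a) = normc z `^ a.
Proof.
rewrite normc_sqrtE /= !exprMn -mulrDr cos2Dsin2 mulr1 sqrtr_sqr ger0_norm//.
exact: powR_ge0.
Qed.

Lemma Cpow1 z : Cpow z 1 = z.
Proof.
have [->|z0] := eqVneq z 0.
  by rewrite /Cpow Normc.normc0 powRr1// !mul0r.
rewrite /Cpow powRr1 ?normc_ge0// !mul1r Re_Carg// Im_Carg//.
by case: (z).
Qed.

Lemma Cpow_neq0 z a : z != 0 -> Cpow z a != 0.
Proof. by rewrite -!normc_gt0 normc_Cpow => /powR_gt0. Qed.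

Lemma CpowN z a : z != 0 -> Cpow z (- a) = (Cpow z a)^-1.
Proof.
move=> z0; have n0 : 0 < normc z `^ a by rewrite powR_gt0// normc_gt0.
apply: eq_complexP; rewrite ?cReV ?cImV normc_Cpow /= powRN mulNr ?cosN ?sinN;
  by field; rewrite gt_eqF.
Qed.

Lemma normcZ t z : 0 <= t -> normc (t%:C * z) = t * normc z.
Proof.
move=> t0; rewrite Normc.normcM; congr (_ * _).
by rewrite normc_sqrtE /= expr0n addr0 sqrtr_sqr ger0_norm.
Qed.

(** A positive factor does not change the argument; for a general factor the identity fails. *)
Lemma Cpow_scale t z a : 0 < t -> Cpow (t%:C * z) a = (t `^ a)%:C * Cpow z a.
Proof.
move=> t0; have -> : Cpow (t%:C * z) a = Complex (t `^ a * normc z `^ a * cos (a * Carg z))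
    (t `^ a * normc z `^ a * sin (a * Carg z)).
  have eC : Carg (t%:C * z) = Carg z.
    rewrite /Carg (normcZ _ (ltW t0)) cReM cImM /= !mul0r subr0 addr0 pmulr_rge0//.
    by rewrite -mulf_div divff ?gt_eqF// mul1r.
  by rewrite /Cpow eC (normcZ _ (ltW t0)) powRM ?normc_ge0// ltW.
by apply: eq_complexP; rewrite ?cReM ?cImM /=; ring.
Qed.

Lemma Cpow_real t a : 0 < t -> Cpow t%:C a = (t `^ a)%:C.
Proof.
move=> t0; have n : normc t%:C = t by rewrite normc_sqrtE /= expr0n addr0 sqrtr_sqr gtr0_norm.
by rewrite /Cpow /Carg n /= lexx divff ?gt_eqF// acos1 mulr0 cos0 sin0 mulr1 mulr0.
Qed.

Lemma slit_planeV z : slit_plane z -> slit_plane z^-1.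
Proof.
move=> zs; have z0 := slit_plane_neq0 zs; have n0 : 0 < normc z by rewrite normc_gt0.
move=> [hR hI]; apply: zs; move: hR hI; rewrite cReV cImV.
by rewrite pmulr_lle0 ?invr_gt0 ?exprn_gt0// => ? /eqP; rewrite mulf_eq0 oppr_eq0 invr_eq0
  expf_eq0 (gt_eqF n0) andbF orbF => /eqP.
Qed.

Lemma CargV z : slit_plane z -> Carg z^-1 = - Carg z.
Proof.
move=> zs; have z0 := slit_plane_neq0 zs; have n0 : 0 < normc z by rewrite normc_gt0.
have m0 := (slit_planeP _).1 zs.
rewrite !Carg_atan//; last exact: slit_planeV.
rewrite -mulrN -atanN cImV cReV Normc.normcV; congr (_ * atan _).
by field; rewrite !gt_eqF.
Qed.

Lemma CpowV z a : slit_plane z -> Cpow z^-1 a = (Cpow z a)^-1.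
Proof.
move=> zs; rewrite -CpowN ?slit_plane_neq0// /Cpow CargV// Normc.normcV mulrN mulNr.
by rewrite -powR_inv1 ?normc_ge0// -powRrM mulN1r.
Qed.

Lemma slit_plane_scale t z : 0 < t -> slit_plane z -> slit_plane (t%:C * z).
Proof.
move=> t0 zs [hR hI]; apply: zs; move: hR hI.
rewrite cReM cImM /= !mul0r subr0 addr0 pmulr_rle0// => ? /eqP.
by rewrite mulf_eq0 gt_eqF//= => /eqP.
Qed.

Lemma slit_plane_real t : 0 < t -> slit_plane t%:C.
Proof. by move=> t0 [/=]; rewrite leNgt t0. Qed.

Lemma slit_plane_addr r z : 0 <= r -> slit_plane z -> slit_plane (r%:C + z).
Proof.
move=> r0 zs [hR hI]; apply: zs; move: hR hI; rewrite cReD cImD /= add0r => h ->.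
by split=> //; lra.
Qed.

(** The imaginary parts of the two inverses have the same sign, so they cannot cancel. *)
Lemma slit_plane_sumV r z : 0 <= r -> slit_plane z ->
  slit_plane (z^-1 + (r%:C + z)^-1).
Proof.
move=> r0 zs; have ws := slit_plane_addr r0 zs.
have nz : 0 < normc z ^+ 2 by rewrite exprn_gt0// normc_gt0 slit_plane_neq0.
have nw : 0 < normc (r%:C + z) ^+ 2 by rewrite exprn_gt0// normc_gt0 slit_plane_neq0.
rewrite /slit_plane/= cReD cImD !cReV !cImV cReD cImD /= add0r => -[hR hI].
have Iz : Im z = 0.
  have : Im z * ((normc z ^+ 2)^-1 + (normc (r%:C + z) ^+ 2)^-1) = 0.
    by rewrite -[RHS]oppr0 -hI; ring.
  move=> /eqP; rewrite mulf_eq0 => /orP[/eqP//|].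
  by rewrite gt_eqF// addr_gt0 ?invr_gt0.
have Rz : 0 < Re z by rewrite ltNge; apply/negP => h; exact: zs.
move: hR; rewrite leNgt => /negP; apply.
by rewrite addr_gt0// divr_gt0//; lra.
Qed.

(** The modulus dominates both the real part and the imaginary part, and adding [r] only helps the
former; the slit plane is where [Re z > 0] or [Im z <> 0]. *)
Lemma slit_plane_dist z : slit_plane z ->
  exists2 e, 0 < e & forall r s, 0 <= r -> 0 <= s -> e * s <= normc (r%:C + s%:C * z).
Proof.
move=> zs; have [Rz|Rz] := ltP 0 (Re z).
  exists (Re z) => // r s r0 s0; apply: le_trans (normRe_le _).
  rewrite cReD cReM /= mul0r subr0 ger0_norm; last by rewrite addr_ge0// mulr_ge0// ltW.
  by rewrite mulrC lerDr.
exists `|Im z|.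
  rewrite normr_gt0; apply/eqP => Iz; exact: zs.
move=> r s r0 s0; apply: le_trans (normIm_le _).
by rewrite cImD cImM /= mul0r addr0 add0r normrM (ger0_norm s0) mulrC.
Qed.

End Cpow_algebra.

(** * Complex valued integrals *)
Section complex_integral.
Context {R : realType}.
Notation Re := complex.Re.
Notation Im := complex.Im.
Notation normc := Normc.normc.
Local Notation D := (`[-1, 1]%classic : set (measurableTypeR R)).
Variable m : {measure set (measurableTypeR R) -> \bar R}.
Hypothesis m_continuous : forall f : R -> R,
  (forall x, -1 <= x <= 1 -> {for x, continuous f}) -> m.-integrable D (EFin \o f).
Implicit Types (F G : R -> R[i]) (c : R[i]) (x s : R).

Definition ccontinuous F := forall x, -1 <= x <= 1 ->
  {for x, continuous (fun t => Re (F t))} /\ {for x, continuous (fun t => Im (F t))}.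

Definition cint F : R[i] :=
  Complex (\int[m]_(x in D) Re (F x)) (\int[m]_(x in D) Im (F x)).

Let mD : measurable D.
Proof. exact: measurable_itv. Qed.

Lemma ccontinuousM F G : ccontinuous F -> ccontinuous G ->
  ccontinuous (fun x => F x * G x).
Proof.
move=> cF cG x x1; have [FR FI] := cF x x1; have [GR GI] := cG x x1; split.
- rewrite (_ : (fun _ => _) = fun t => Re (F t) * Re (G t) - Im (F t) * Im (G t)).
    by apply: cvgB; exact: cvgM.
  by apply/funext => t; rewrite cReM.
- rewrite (_ : (fun _ => _) = fun t => Re (F t) * Im (G t) + Im (F t) * Re (G t)).
    by apply: cvgD; exact: cvgM.
  by apply/funext => t; rewrite cImM.
Qed.

Lemma ccontinuous_const c : ccontinuous (fun=> c).
Proof. by move=> x _; split; exact: cvg_cst. Qed.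

Lemma eq_cint F G : (forall x, -1 <= x <= 1 -> F x = G x) -> cint F = cint G.
Proof.
move=> FG; apply: eq_complexP; apply: eq_Rintegral => x; rewrite in_DE => x1; by rewrite FG.
Qed.

Lemma cintZ c F : ccontinuous F -> cint (fun x => c * F x) = c * cint F.
Proof.
move=> cF.
have iR : m.-integrable D (EFin \o (fun x => Re (F x))).
  by apply: m_continuous => x /cF[].
have iI : m.-integrable D (EFin \o (fun x => Im (F x))).
  by apply: m_continuous => x /cF[].
have cZ (a : R) (f : R -> R) : m.-integrable D (EFin \o f) ->
    m.-integrable D (EFin \o (fun x => a * f x)).
  by move=> h; apply: (integrableZl mD a h).
apply: eq_complexP; rewrite ?cReM ?cImM /=.
- under eq_Rintegral do rewrite cReM.
  rewrite RintegralB//; [|exact: cZ..].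
  by rewrite !RintegralZl.
- under eq_Rintegral do rewrite cImM.
  rewrite RintegralD//; [|exact: cZ..].
  by rewrite !RintegralZl.
Qed.

Lemma cintB F G : ccontinuous F -> ccontinuous G ->
  cint (fun x => F x - G x) = cint F - cint G.
Proof.
move=> cF cG; apply: eq_complexP; rewrite ?cReD ?cImD ?cReN ?cImN /=.
- under eq_Rintegral do rewrite cReD cReN.
  by rewrite RintegralB//; apply: m_continuous => x; [case/cF|case/cG].
- under eq_Rintegral do rewrite cImD cImN.
  by rewrite RintegralB//; apply: m_continuous => x; [case/cF|case/cG].
Qed.

Let derive_under (f df : R -> R -> R) (a u v C : R) : u < a < v ->
  (forall s, u < s < v -> forall x, -1 <= x <= 1 -> {for x, continuous (f s)}) ->
  (forall s x, u < s < v -> -1 <= x <= 1 -> is_derive s 1 (f ^~ x) (df s x)) ->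
  (forall s x, u < s < v -> -1 <= x <= 1 -> `|df s x| <= C) ->
  is_derive a 1 (fun s => \int[m]_(x in D) f s x) (\int[m]_(x in D) df a x).
Proof.
move=> uav cf ddf dfC.
have Ia : `]u, v[%classic a by rewrite /= in_itv.
have intf s : `]u, v[%classic s -> m.-integrable D (EFin \o f s).
  by rewrite /= in_itv/= => uv; apply: m_continuous; exact: cf.
have derf s x : `]u, v[%classic s -> D x -> derivable (f ^~ x) s 1.
  by rewrite /= !in_itv/= => uv x1; have [] := ddf s x uv x1.
have intC : m.-integrable D (EFin \o (fun=> `|C|)).
  by apply: m_continuous => x _; exact: cvg_cst.
have bnd s x : `]u, v[%classic s -> D x -> `|(f ^~ x)^`()%classic s| <= `|C|.
  rewrite /= !in_itv/= => uv x1; have h := ddf s x uv x1.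
  by rewrite derive1E derive_val; apply: (le_trans (dfC _ _ uv x1)); exact: ler_norm.
apply: DeriveDef.
  exact: (derivable_under_integral mD Ia intf derf (fun=> normr_ge0 C) intC bnd).
rewrite -derive1E (differentiation_under_integral mD Ia intf derf (fun=> normr_ge0 C) intC bnd).
apply: eq_Rintegral => x; rewrite in_DE => x1.
by have h := ddf a x uav x1; rewrite /partial1of2 derive1E derive_val.
Qed.

(** Dominated by a constant, which is integrable because the measure is finite. *)
Lemma cderive_cint (F dF : R -> R -> R[i]) (a u v C : R) : u < a < v ->
  (forall s, u < s < v -> ccontinuous (F s)) ->
  (forall s x, u < s < v -> -1 <= x <= 1 -> is_cderive (F ^~ x) s (dF s x)) ->
  (forall s x, u < s < v -> -1 <= x <= 1 -> normc (dF s x) <= C) ->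
  is_cderive (fun s => cint (F s)) a (cint (dF a)).
Proof.
move=> uav cF ddF dFC; split.
- apply: (derive_under (f := fun s x => Re (F s x)) (df := fun s x => Re (dF s x)) uav).
  + by move=> s uv x x1; have [] := cF s uv x x1.
  + by move=> s x uv x1; have [] := ddF s x uv x1.
  + by move=> s x uv x1; apply: le_trans (dFC s x uv x1); exact: normRe_le.
- apply: (derive_under (f := fun s x => Im (F s x)) (df := fun s x => Im (dF s x)) uav).
  + by move=> s uv x x1; have [] := cF s uv x x1.
  + by move=> s x uv x1; have [] := ddF s x uv x1.
  + by move=> s x uv x1; apply: le_trans (dFC s x uv x1); exact: normIm_le.
Qed.

End complex_integral.

(** * The transform along a ray from 1 *)
Section transform_along_ray.
Context {R : realType}.
Notation Re := complex.Re.
Notation Im := complex.Im.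
Notation normc := Normc.normc.
Notation "x %:C" := (real_complex R x) : ring_scope.
Variables (l : R) (l1 : 1 <= l) (w : R[i]).
Hypothesis ws : slit_plane w.
Implicit Types (x s : R).
Notation cintegral := (cint (mu_l l1)).

Let c_int := @cintZ R (mu_l l1) (integrable_mu_l l1).

(** [ray 1] is the point at which the transform is wanted, for [w = z - 1]. *)
Definition ray s : R[i] := 1%:C + s%:C * w.

Definition gap s x : R[i] := (1 - x)%:C + s%:C * w.

Definition power_kernel s x : R[i] := Cpow (gap s x) (- l).

Definition transform s : R[i] := cintegral (power_kernel s).

Definition transform1 s : R[i] := cintegral (fun x => power_kernel s x / gap s x).

Lemma slit_plane_gap s x : 0 < s -> x <= 1 -> slit_plane (gap s x).
Proof.
by move=> s0 x1; apply: slit_plane_addr; [rewrite subr_ge0|exact: slit_plane_scale].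
Qed.

Lemma gap_neq0 s x : 0 < s -> x <= 1 -> gap s x != 0.
Proof. by move=> s0 x1; apply/slit_plane_neq0/slit_plane_gap. Qed.

Lemma gapE s x : gap s x = ray s - x%:C.
Proof. by rewrite /gap /ray rmorphB/= addrAC. Qed.

Lemma cderive_gap_x s x : is_cderive (gap s) x (- 1).
Proof.
have h := cderive_add (cderive_const x (ray s))
  (cderive_mul (cderive_const x (- 1)) (cderive_real x)).
have -> : gap s = fun t => ray s + -1 * t%:C by apply/funext => t; rewrite gapE mulN1r.
by apply: (cderive_eq h); ring.
Qed.

Lemma cderive_kernel_x s x : 0 < s -> x <= 1 ->
  is_cderive (power_kernel s) x (l%:C * (power_kernel s x / gap s x)).
Proof.
move=> s0 x1; have g0 := gap_neq0 s0 x1.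
apply: (cderive_eq (cderive_Cpow (- l) (cderive_gap_x s x) (slit_plane_gap s0 x1))).
by rewrite rmorphN /power_kernel; field.
Qed.

Lemma cderive_gap_kernel_x s x : 0 < s -> x <= 1 ->
  is_cderive (fun x => gap s x * power_kernel s x) x ((l - 1)%:C * power_kernel s x).
Proof.
move=> s0 x1; have g0 := gap_neq0 s0 x1.
apply: (cderive_eq (cderive_mul (cderive_gap_x s x) (cderive_kernel_x s0 x1))).
by rewrite rmorphB/=; field.
Qed.

Lemma cderive_kernel_gapV_x s x : 0 < s -> x <= 1 -> exists d,
  is_cderive (fun x => power_kernel s x / gap s x) x d.
Proof.
move=> s0 x1; have g0 := gap_neq0 s0 x1; eexists.
exact: (cderive_mul (cderive_kernel_x s0 x1) (cderive_inv g0 (cderive_gap_x s x))).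
Qed.

Lemma ccontinuous_kernel s : 0 < s -> ccontinuous (power_kernel s).
Proof. by move=> s0 x /andP[_ x1]; exact: cderive_continuous (cderive_kernel_x s0 x1). Qed.

Lemma ccontinuous_kernel_gapV s : 0 < s -> ccontinuous (fun x => power_kernel s x / gap s x).
Proof.
move=> s0 x /andP[_ x1]; have [d h] := cderive_kernel_gapV_x s0 x1.
exact: cderive_continuous h.
Qed.

(** The weak equation of the measure for the three consecutive powers of [gap], with [x] replaced
by [ray s - gap s x]. *)
Lemma transform_relation s : 0 < s ->
  (ray s ^+ 2 + 1) * transform s = ray s * (ray s ^+ 2 - 1) * transform1 s.
Proof.
move=> s0.
pose W x := x%:C * (1 - x ^+ 2)%:C * (power_kernel s x / gap s x) +
  2 * (1 - x ^+ 2)%:C * power_kernel s x - x%:C * (gap s x * power_kernel s x).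
have ReZ (a : R) z : Re (a%:C * z) = a * Re z by rewrite cReM /= mul0r subr0.
have ImZ (a : R) z : Im (a%:C * z) = a * Im z by rewrite cImM /= mul0r addr0.
have W0 : cintegral W = 0.
  apply: eq_complexP => /=.
  - apply: (etrans _ (@mu_l_weak R l l1 (fun x => Re (gap s x * power_kernel s x))
      (fun x => Re (power_kernel s x)) (fun x => Re (power_kernel s x / gap s x)) _ _ _)).
    + apply: eq_Rintegral => x _; rewrite /W /weak_integrand !cReD cReN !cReM !cImM /=; ring.
    + move=> x /andP[_ x1]; have [+ _] := cderive_gap_kernel_x s0 x1.
      by rewrite ReZ.
    + move=> x /andP[_ x1]; have [+ _] := cderive_kernel_x s0 x1.
      by rewrite ReZ.
    + by move=> x x1; have [] := ccontinuous_kernel_gapV s0 x1.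
  - apply: (etrans _ (@mu_l_weak R l l1 (fun x => Im (gap s x * power_kernel s x))
      (fun x => Im (power_kernel s x)) (fun x => Im (power_kernel s x / gap s x)) _ _ _)).
    + apply: eq_Rintegral => x _; rewrite /W /weak_integrand !cImD cImN !cImM !cReM /=; ring.
    + move=> x /andP[_ x1]; have [_ +] := cderive_gap_kernel_x s0 x1.
      by rewrite ImZ.
    + move=> x /andP[_ x1]; have [_ +] := cderive_kernel_x s0 x1.
      by rewrite ImZ.
    + by move=> x x1; have [] := ccontinuous_kernel_gapV s0 x1.
have ck := ccontinuous_kernel s0; have ckg := ccontinuous_kernel_gapV s0.
apply/eqP; rewrite -subr_eq0 -W0 -!c_int// -cintB; first last.
- by apply: ccontinuousM => //; exact: ccontinuous_const.
- by apply: ccontinuousM => //; exact: ccontinuous_const.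
- exact: integrable_mu_l.
apply/eqP/eq_cint => x /andP[_ x1]; have g0 := gap_neq0 s0 x1.
have -> : ray s = gap s x + x%:C by rewrite gapE subrK.
rewrite /W rmorphB rmorphXn rmorph1 /=; field.
exact: g0.
Qed.


Lemma normc_kernel s x : normc (power_kernel s x) = (normc (gap s x) `^ l)^-1.
Proof. by rewrite normc_Cpow powRN. Qed.

(** On the interval of radius [s / 2] to the left and [s] to the right of [s], [gap] is at least
[e * (s / 2)] in modulus, uniformly in [x]. *)
Lemma cderive_transform s : 0 < s ->
  is_cderive transform s (- l%:C * w * transform1 s).
Proof.
move=> s0; have l0 : 0 <= l by apply: le_trans l1.
have [e e0 gap_ge] := slit_plane_dist ws.
have [d1 d2] : s / 2 < s /\ s < 2 * s by split; lra.
have cs : s / 2 < s < 2 * s by rewrite d1 d2.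
pose dk t x := - l%:C * w * (power_kernel t x / gap t x).
have -> : - l%:C * w * transform1 s = cintegral (dk s).
  by rewrite c_int//; exact: ccontinuous_kernel_gapV.
pose C := l * normc w * (((e * (s / 2)) `^ l)^-1 / (e * (s / 2))).
have pos t : s / 2 < t < 2 * s -> 0 < t by move=> /andP[]; lra.
apply: (@cderive_cint R (mu_l l1) (integrable_mu_l l1) power_kernel dk s (s / 2) (2 * s) C cs).
- by move=> t /pos; exact: ccontinuous_kernel.
- move=> t x /pos t0 /andP[_ x1]; have g0 := gap_neq0 t0 x1.
  have h : is_cderive (gap ^~ x) t w.
    apply: (cderive_eq (cderive_add (cderive_const t ((1 - x)%:C))
      (cderive_mul (cderive_real t) (cderive_const t w)))).
    by rewrite mul1r mulr0 addr0 add0r.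
  apply: (cderive_eq (cderive_Cpow (- l) h (slit_plane_gap t0 x1))).
  by rewrite /dk rmorphN /power_kernel; field.
- move=> t x t01 /andP[_ x1]; have t0 := pos t t01; have g0 := gap_neq0 t0 x1.
  have es : 0 < e * (s / 2) by rewrite mulr_gt0//; lra.
  have ge : e * (s / 2) <= normc (gap t x).
    apply: le_trans (gap_ge (1 - x) t _ _); [|lra|lra].
    by rewrite ler_pM2l//; move: t01 => /andP[]; lra.
  have n0 : 0 < normc (gap t x) by apply: lt_le_trans ge.
  rewrite /dk /C !Normc.normcM Normc.normcV normc_kernel normcN.
  have -> : normc l%:C = l by rewrite normc_sqrtE /= expr0n addr0 sqrtr_sqr ger0_norm.
  apply: ler_wpM2l; first by rewrite mulr_ge0// normc_ge0.
  apply: ler_pM; rewrite ?invr_ge0 ?powR_ge0 ?normc_ge0//.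
    rewrite lef_pV2 ?posrE ?powR_gt0//.
    by apply: ge0_ler_powR => //; rewrite nnegrE ltW.
  by rewrite lef_pV2 ?posrE.
Qed.

(** The ordinary Stieltjes transform of the symmetric Bernoulli law at [ray s], where
[ray s - 1 = s w]. *)
Definition bernoulli_transform s : R[i] :=
  (2^-1)%:C * ((s%:C * w)^-1 + (2%:C + s%:C * w)^-1).

Lemma slit_plane_bernoulli s : 0 < s -> slit_plane (bernoulli_transform s).
Proof.
move=> s0; apply: slit_plane_scale; first by rewrite invr_gt0.
by apply: slit_plane_sumV => //; exact: slit_plane_scale.
Qed.

Definition normalized s : R[i] := Cpow (bernoulli_transform s) (- l) * transform s.

(** The logarithmic derivatives of the two factors cancel by [transform_relation]. *)
Lemma cderive_normalized s : 0 < s -> is_cderive normalized s 0.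
Proof.
move=> s0; have sw0 : s%:C * w != 0 by apply/slit_plane_neq0/slit_plane_scale.
have s2 : slit_plane (2%:C + s%:C * w) by apply: slit_plane_addr => //; exact: slit_plane_scale.
have sw2 := slit_plane_neq0 s2.
have dsw : is_cderive (fun t => t%:C * w) s w.
  apply: (cderive_eq (cderive_mul (cderive_real s) (cderive_const s w))).
  by rewrite mul1r mulr0 addr0.
have dsw2 := cderive_add (cderive_const s 2%:C) dsw.
have dB := cderive_mul (cderive_const s (2^-1)%:C)
  (cderive_add (cderive_inv sw0 dsw) (cderive_inv sw2 dsw2)).
have Bs := slit_plane_bernoulli s0.
apply: (cderive_eq (cderive_mul (cderive_Cpow (- l) dB Bs) (cderive_transform s0))).
have r0 : ray s != 0.
  have := gap_neq0 s0 (ler01 : (0 : R) <= 1); by rewrite gapE subr0.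
have R1 : ray s = 1 + s%:C * w by [].
have r21 : ray s ^+ 2 - 1 = s%:C * w * (2 + s%:C * w) by rewrite R1; ring.
have r210 : ray s ^+ 2 - 1 != 0.
  by rewrite r21 mulf_neq0//; have := sw2; rewrite rmorph_nat.
have T1 : transform1 s = (ray s ^+ 2 + 1) * transform s / (ray s * (ray s ^+ 2 - 1)).
  by rewrite transform_relation//; field; rewrite r0 r210.
rewrite T1 r21 /bernoulli_transform !rmorph_nat fmorphV rmorph_nat R1.
move: r0 sw2; rewrite R1 rmorph_nat; set v := s%:C * w in sw0 *; move=> r0 sw2.
set P := Cpow _ _; rewrite rmorphN; field.
rewrite sw0 sw2 r0 /=.
have -> : 2 + v + v = 2 * (1 + v) by ring.
by rewrite mulf_neq0// pnatr_eq0.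
Qed.

Lemma normalized_constant s : 0 < s -> s <= 1 -> normalized s = normalized 1.
Proof.
move=> s0 s1.
have dr t : s <= t -> is_cderive normalized t 0.
  by move=> st; apply: cderive_normalized; exact: lt_le_trans st.
have cr (phi : R[i] -> R) : (forall t, s <= t -> is_derive t 1 (fun t => phi (normalized t)) 0) ->
    phi (normalized s) = phi (normalized 1).
  move=> dphi; apply/esym/eqP; rewrite -subr_eq0.
  have [t| |t _ ->] := @MVT_segment R (fun t => phi (normalized t)) (fun=> 0) s 1 s1.
  - by rewrite in_itv/= => /andP[/ltW st _]; exact: dphi.
  - apply: continuous_in_subspaceT => t; rewrite inE/= in_itv/= => /andP[st _].
    exact: derive_continuous (dphi t st).
  - by rewrite mul0r.
by apply: eq_complexP; apply: cr => t /dr[].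
Qed.

(** Near the origin of the ray only the atom at [1] counts: the kernel at any other point stays
bounded, while [s `^ l] times the kernel is bounded uniformly in [s] and [x]. The functional
[phi] is the real or the imaginary part. *)
Lemma cvg_scaled_transform (phi : R[i] -> R) :
  (forall z, `|phi z| <= normc z) -> (forall a z, phi (a%:C * z) = a * phi z) ->
  (forall s x, 0 < s -> -1 <= x <= 1 -> {for x, continuous (fun t => phi (power_kernel s t))}) ->
  (fun n => harmonic n `^ l * \int[mu_l l1]_(x in `[-1, 1]) phi (power_kernel (harmonic n) x))
    @ \oo --> phi (Cpow w (- l)) * (2 `^ l)^-1.
Proof.
move=> phi_le phiZ cphi.
have [e e0 gap_ge] := slit_plane_dist ws.
have l0 : 0 < l by apply: lt_le_trans l1.
have h0 n : 0 < harmonic n :> R by exact: harmonic_gt0.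
pose D : set (measurableTypeR R) := `[-1, 1]%classic.
have mD : measurable D by exact: measurable_itv.
pose f n x := harmonic n `^ l * phi (power_kernel (harmonic n) x).
pose g x := phi (Cpow w (- l)) * \1_[set 1] x.
have cf n x : -1 <= x <= 1 -> {for x, continuous (f n)}.
  by move=> x1; apply: cvgM; [exact: cvg_cst|exact: cphi].
have f_le n x : -1 <= x <= 1 -> `|f n x| <= harmonic n `^ l * (normc (gap (harmonic n) x) `^ l)^-1.
  move=> x1; rewrite normrM ger0_norm ?powR_ge0// -normc_kernel.
  by rewrite ler_wpM2l ?powR_ge0.
have f_bound n x : -1 <= x <= 1 -> `|f n x| <= (e `^ l)^-1.
  move=> x1; apply: (le_trans (f_le n x x1)).
  have := gap_ge (1 - x) (harmonic n) _ (ltW (h0 n)).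
  rewrite -/(gap (harmonic n) x) => /(_ _)/wrap[|ge]; first by lra.
  have eh : 0 < e * harmonic n by rewrite mulr_gt0.
  rewrite ler_pdivrMr; last by rewrite powR_gt0//; exact: lt_le_trans ge.
  rewrite mulrC ler_pdivlMr ?powR_gt0// -(powRM _ (ltW (h0 n)) (ltW e0)) [harmonic n * e]mulrC.
  by apply: ge0_ler_powR; rewrite ?nnegrE ?normc_ge0// ltW.
have f_cvg x : -1 <= x <= 1 -> (fun n => f n x) @ \oo --> g x.
  move=> x1; rewrite /g indicE; have [->|xn1] := eqVneq x 1.
    rewrite mem_set// mulr1; apply: cvg_near_cst; apply: nearW => n.
    rewrite /f /power_kernel /gap subrr rmorph0 add0r Cpow_scale// phiZ mulrA.
    by rewrite powRN divff ?mul1r// gt_eqF// powR_gt0.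
  rewrite memNset; last by move=> /= h; rewrite h eqxx in xn1.
  rewrite mulr0.
  have x_lt1 : 0 < 1 - x by rewrite subr_gt0 lt_neqAle xn1; case/andP : x1.
  have h_cvg : (harmonic : nat -> R) @ \oo --> 0 by exact: cvg_harmonic.
  have hl_cvg : (fun n => harmonic n `^ l : R) @ \oo --> 0.
    have -> : (fun n => harmonic n `^ l : R) = (fun y : R => `|y| `^ l) \o harmonic.
      by apply/funext => n; rewrite /comp ger0_norm// ltW.
    have <- : `|0 : R| `^ l = 0 by rewrite normr0 powR0// gt_eqF.
    exact: continuous_cvg _ (@continuous_abs_powR R l l0 0) h_cvg.
  have b_cvg : (fun n => harmonic n `^ l * (((1 - x) / 2) `^ l)^-1) @ \oo --> 0.
    by rewrite -(mul0r (((1 - x) / 2) `^ l)^-1); apply: cvgM => //; exact: cvg_cst.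
  apply: norm_cvg0; apply: squeeze_cvgr (cvg_cst 0) b_cvg.
  have : \forall n \near \oo, harmonic n * normc w < (1 - x) / 2.
    have : (fun n => harmonic n * normc w) @ \oo --> 0.
      by rewrite -(mul0r (normc w)); apply: cvgM => //; exact: cvg_cst.
    by move=> hw; apply: (cvgr_lt _ hw); lra.
  apply: filterS => n hn; rewrite normr_ge0/=; apply: (le_trans (f_le n x x1)).
  rewrite ler_wpM2l ?powR_ge0// lef_pV2 ?posrE; last 2 first.
  - rewrite powR_gt0// normc_gt0; apply: gap_neq0 => //; by case/andP : x1.
  - by rewrite powR_gt0//; lra.
  apply: ge0_ler_powR; rewrite ?nnegrE ?normc_ge0//; try lra.
  have : normc ((1 - x)%:C) <= normc (gap (harmonic n) x) + normc (- ((harmonic n)%:C * w)).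
    by apply: le_trans (le_normcD _ _); rewrite /gap addrK.
  rewrite normcN (normcZ _ (ltW (h0 n))).
  have -> : normc (1 - x)%:C = 1 - x by rewrite normc_sqrtE /= expr0n addr0 sqrtr_sqr gtr0_norm.
  by move: hn; lra.
have if_ n : (mu_l l1).-integrable D (EFin \o f n) by apply: integrable_mu_l; exact: cf.
have ms1 : measurable ([set 1] : set (measurableTypeR R)) by exact: measurable_set1.
have m1 : measurable_fun D (\1_[set 1] : measurableTypeR R -> R).
  exact: measurable_indic.
have mg : measurable_fun D g by exact: measurable_funM.
have [|||||ig _ lim] := @dominated_convergence _ _ _ (mu_l l1) D mD (fun n x => (f n x)%:E)
  (fun x => (g x)%:E) (fun=> ((e `^ l)^-1)%:E).
- by move=> n; case/integrableP : (if_ n).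
- exact/measurable_EFinP.
- apply: aeW => x; rewrite /D /= in_itv/= => x1.
  by apply: cvg_EFin; [exact: nearW|exact: f_cvg].
- by apply: (integrable_mu_l l1 (f := fun=> (e `^ l)^-1)) => x _; exact: cvg_cst.
- apply: aeW => x n; rewrite /D /= in_itv/= => x1; rewrite lee_fin; exact: f_bound.
have int_g : (\int[mu_l l1]_(x in D) (g x)%:E = (phi (Cpow w (- l)) * (2 `^ l)^-1)%:E)%E.
  rewrite /g; under eq_integral do rewrite EFinM.
  rewrite integralZl//; last first.
    have i1 : (mu_l l1).-integrable D (EFin \o cst 1).
      by apply: integrable_mu_l => x _; exact: cvg_cst.
    apply: (le_integrable mD _ _ i1).
    - exact/measurable_EFinP.
    - by move=> x _; rewrite /= lee_fin normr1 indicE ger0_norm//; case: (_ \in _).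
  rewrite integral_indic//.
  rewrite setIidl; last by move=> x ->; rewrite /D /= in_itv/= lexx andbT ge0_cp.
  by rewrite EFinM; congr (_ * _)%E; exact: mu_l_set1.
have -> : (fun n => harmonic n `^ l * \int[mu_l l1]_(x in D) phi (power_kernel (harmonic n) x)) =
    fun n => \int[mu_l l1]_(x in D) f n x.
  apply/funext => n; rewrite RintegralZl//; apply: integrable_mu_l => x x1; exact: cphi.
by apply: fine_cvg; rewrite -int_g; exact: lim.
Qed.

(** The constant value along the ray, computed at its origin. *)
Lemma normalized1 : normalized 1 = 1.
Proof.
have h0 n : 0 < harmonic n :> R by exact: harmonic_gt0.
have h1 n : harmonic n <= 1 :> R by rewrite /= invf_le1// ler1n.
have w0 := slit_plane_neq0 ws.
(* [V s = s * bernoulli_transform s] for [s > 0], but [V] is smooth at [0] as well. *)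
pose V s : R[i] := (2^-1)%:C * (w^-1 + s%:C * (2%:C + s%:C * w)^-1).
have V0 : V 0 = (2^-1)%:C * w^-1 by rewrite /V rmorph0 mul0r addr0.
have normalizedE n : normalized (harmonic n) =
    Cpow (V (harmonic n)) (- l) * ((harmonic n `^ l)%:C * transform (harmonic n)).
  set s : R := harmonic n; have s0 : 0 < s := h0 n.
  have -> : V s = s%:C * bernoulli_transform s.
    have sC : s%:C != 0 by rewrite slit_plane_neq0//; exact: slit_plane_real.
    rewrite /V /bernoulli_transform invfM.
    rewrite [RHS]mulrCA; congr (_ * _); rewrite mulrDr; congr (_ + _).
    by rewrite mulrA divff// mul1r.
  rewrite Cpow_scale// /normalized powRN [_ * ((s `^ l)%:C * _)]mulrCA !mulrA; congr (_ * _).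
  by rewrite -rmorphM divff ?rmorph1 ?mul1r// gt_eqF// powR_gt0.
have [dV hV] : exists d, is_cderive V 0 d.
  have n2 : 2%:C + 0%:C * w != 0.
    by rewrite rmorph0 mul0r addr0 slit_plane_neq0//; exact: slit_plane_real.
  have d2 := cderive_add (cderive_const 0 2%:C) (cderive_mul (cderive_real 0) (cderive_const 0 w)).
  have d3 := cderive_mul (cderive_real 0) (cderive_inv (f := fun t => 2%:C + t%:C * w) n2 d2).
  eexists; exact: (cderive_mul (cderive_const 0 (2^-1)%:C) (cderive_add (cderive_const 0 w^-1) d3)).
have Vs : slit_plane (V 0).
  by rewrite V0; apply: slit_plane_scale; [rewrite invr_gt0|exact: slit_planeV].
have [cVR cVI] := cderive_continuous (cderive_Cpow (- l) hV Vs).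
have CV0 : Cpow (V 0) (- l) = (2 `^ l)%:C * Cpow w l.
  rewrite V0 Cpow_scale ?invr_gt0// CpowV// CpowN// invrK; congr (_%:C * _).
  by rewrite -powR_inv1// -powRrM mulrNN mul1r.
have limit : (2 `^ l)%:C * Cpow w l * ((2 `^ l)^-1%:C * Cpow w (- l)) = 1.
  rewrite CpowN// fmorphV; field.
  by rewrite Cpow_neq0//= slit_plane_neq0//; apply: slit_plane_real; rewrite powR_gt0.
have h_cvg : (harmonic : nat -> R) @ \oo --> 0 by exact: cvg_harmonic.
have lR := continuous_cvg _ cVR h_cvg; have lI := continuous_cvg _ cVI h_cvg.
have ReZ (a : R) z : Re (a%:C * z) = a * Re z by rewrite cReM /= mul0r subr0.
have ImZ (a : R) z : Im (a%:C * z) = a * Im z by rewrite cImM /= mul0r addr0.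
have tR : (fun n => Re ((harmonic n `^ l)%:C * transform (harmonic n))) @ \oo -->
    Re ((2 `^ l)^-1%:C * Cpow w (- l)).
  rewrite ReZ mulrC; under eq_fun do rewrite ReZ.
  apply: (cvg_scaled_transform (@normRe_le R) ReZ) => s x s0 x1.
  by have [] := ccontinuous_kernel s0 x1.
have tI : (fun n => Im ((harmonic n `^ l)%:C * transform (harmonic n))) @ \oo -->
    Im ((2 `^ l)^-1%:C * Cpow w (- l)).
  rewrite ImZ mulrC; under eq_fun do rewrite ImZ.
  apply: (cvg_scaled_transform (@normIm_le R) ImZ) => s x s0 x1.
  by have [] := ccontinuous_kernel s0 x1.
have normalized_cvg : (fun n => Re (normalized (harmonic n))) @ \oo --> Re (1 : R[i]) /\
    (fun n => Im (normalized (harmonic n))) @ \oo --> Im (1 : R[i]).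
  rewrite -limit -CV0; split.
  - rewrite cReM; under eq_fun do rewrite normalizedE cReM.
    by apply: cvgB; apply: cvgM; [exact: lR|exact: tR|exact: lI|exact: tI].
  - rewrite cImM; under eq_fun do rewrite normalizedE cImM.
    by apply: cvgD; apply: cvgM; [exact: lR|exact: tI|exact: lI|exact: tR].
have [rR rI] := normalized_cvg; apply: eq_complexP.
- move: rR; under eq_fun do rewrite normalized_constant//.
  by move=> rR; exact: (cvg_unique _ (cvg_cst _) rR).
- move: rI; under eq_fun do rewrite normalized_constant//.
  by move=> rI; exact: (cvg_unique _ (cvg_cst _) rI).
Qed.

End transform_along_ray.

(** * The identity and the total mass *)
Section conclusion.
Context {R : realType}.
Notation Re := complex.Re.
Notation Im := complex.Im.
Notation normc := Normc.normc.
Notation "x %:C" := (real_complex R x) : ring_scope.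
Variables (l : R) (l1 : 1 <= l).
Implicit Types (z : R[i]) (x t : R).

Lemma gap1E z x : gap (z - 1) 1 x = z - x%:C.
Proof. by rewrite /gap rmorphB rmorph1 mul1r; ring. Qed.

Lemma bernoulli_transform1E z :
  bernoulli_transform (z - 1) 1 = (2^-1)%:C * ((z - 1)^-1 + (z + 1)^-1).
Proof.
rewrite /bernoulli_transform rmorph1 mul1r rmorph_nat.
by congr (_ * (_ + _^-1)); ring.
Qed.

Lemma transform1_stieltjes z : slit_plane (z - 1) ->
  stieltjes l (mu_l l1) z = transform l1 (z - 1) 1.
Proof.
move=> zs; have kE x : x \in (`[-1, 1]%classic : set (measurableTypeR R)) ->
    (Cpow (z - x%:C) l)^-1 = power_kernel l (z - 1) 1 x.
  rewrite in_DE => /andP[_ x1]; rewrite /power_kernel gap1E CpowN//.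
  by rewrite -gap1E; exact: gap_neq0.
rewrite /stieltjes /Cintegral /transform /cint !Rintegral_mu_l_setT.
by congr Complex; apply: eq_Rintegral => x /kE ->.
Qed.

Lemma stieltjes_bernoulli z : slit_plane (z - 1) ->
  stieltjes 1 (@sym_bernoulli R) z = bernoulli_transform (z - 1) 1.
Proof.
move=> zs; have d x : -1 <= x <= 1 -> exists d, is_cderive (fun x => (gap (z - 1) 1 x)^-1) x d.
  move=> /andP[_ x1]; eexists; apply: cderive_inv (cderive_gap_x _ _ _).
  exact: gap_neq0.
have kE x : (Cpow (z - x%:C) 1)^-1 = (gap (z - 1) 1 x)^-1 by rewrite Cpow1 gap1E.
have half w : (2^-1)%:C * w = Complex (Re w / 2) (Im w / 2).
  by apply: eq_complexP; rewrite ?cReM ?cImM /=; ring.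
rewrite bernoulli_transform1E half /stieltjes /Cintegral; congr Complex.
- under eq_Rintegral do rewrite kE.
  rewrite Rintegral_sym_bernoulli; last by move=> x /d[dx /cderive_continuous[]].
  by rewrite -cReD !gap1E rmorphN rmorph1 opprK.
- under eq_Rintegral do rewrite kE.
  rewrite Rintegral_sym_bernoulli; last by move=> x /d[dx /cderive_continuous[]].
  by rewrite -cImD !gap1E rmorphN rmorph1 opprK.
Qed.

Lemma stieltjes_mu_l z : slit_plane (z - 1) ->
  stieltjes l (mu_l l1) z = Cpow (stieltjes 1 (@sym_bernoulli R) z) l.
Proof.
move=> zs; rewrite transform1_stieltjes// stieltjes_bernoulli//.
have b0 := slit_plane_neq0 (slit_plane_bernoulli zs ltr01).
have := normalized1 l1 zs; rewrite /normalized CpowN// => h.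
by apply: (mulfI (_ : (Cpow (bernoulli_transform (z - 1) 1) l)^-1 != 0));
  rewrite ?h ?mulVf ?invr_eq0 ?Cpow_neq0.
Qed.

(** For real [t > 1] the transform is [b `^ l] with [b = t / (t ^ 2 - 1)], and
[t - x] lies between [t - 1] and [t + 1]; so the mass is squeezed between powers that tend
to [1] with [t] at infinity. *)
Lemma mu_l_mass : mu_l l1 [set: R] = 1%E.
Proof.
rewrite mu_l_setT; set D := `[-1, 1]%classic.
have mD : measurable (D : set (measurableTypeR R)) by exact: measurable_itv.
have l0 : 0 <= l by apply: le_trans l1.
have mfin : mu_l l1 D \is a fin_num by rewrite ge0_fin_numE// mu_l_lty.
rewrite -(fineK mfin); congr (_%:E); set m := fine _.
pose q t : R := (t / (t - 1)) `^ l.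
have bounds t : 1 < t -> (q t)^-1 <= m <= q t.
  move=> t1.
  pose b : R := 2^-1 * ((t - 1)^-1 + (t + 1)^-1).
  have b0 : 0 < b by rewrite mulr_gt0// addr_gt0// invr_gt0; lra.
  have ts : slit_plane (t%:C - 1).
    have -> : t%:C - 1 = (t - 1)%:C by rewrite rmorphB rmorph1.
    by apply: slit_plane_real; rewrite subr_gt0.
  have bE : bernoulli_transform (t%:C - 1) 1 = b%:C.
    rewrite bernoulli_transform1E /b rmorphM (rmorphD _ (t - 1)^-1) !fmorphV.
    by rewrite (rmorphB _ t) (rmorphD _ t) rmorph1.
  have kE x : x \in (D : set (measurableTypeR R)) ->
      Re (power_kernel l (t%:C - 1) 1 x) = ((t - x) `^ l)^-1.
    rewrite in_DE => /andP[_ x1]; rewrite /power_kernel gap1E -rmorphB Cpow_real/= ?powRN//.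
    lra.
  have : \int[mu_l l1]_(x in D) ((t - x) `^ l)^-1 = b `^ l.
    have <- : Re (Cpow b%:C l) = b `^ l by rewrite Cpow_real.
    rewrite -bE -stieltjes_bernoulli// -stieltjes_mu_l// transform1_stieltjes//=.
    by apply: eq_Rintegral => x /kE.
  have cst_int (c : R) : \int[mu_l l1]_(x in D) c = c * m.
    by rewrite Rintegral_cst//; exact: measurable_itv.
  have int_cst (c : R) : (mu_l l1).-integrable D (EFin \o fun=> c).
    by apply: integrable_mu_l => x _; exact: cvg_cst.
  have int_k : (mu_l l1).-integrable D (EFin \o fun x => ((t - x) `^ l)^-1).
    apply: integrable_mu_l => x /andP[_ x1].
    have tx : 0 < t - x by lra.
    have d := derive_comp (g := fun x => t - x) (is_derive1_powR l tx)
      (derive_add (derive_const t) (derive_opp derive_var)).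
    exact: (derive_continuous (derive_inv (f := fun x => (t - x) `^ l)
      (lt0r_neq0 (powR_gt0 l tx)) d)).
  move=> int_eq.
  have le_pow (u v : R) : 0 < u -> u <= v -> (v `^ l)^-1 <= (u `^ l)^-1.
    move=> u0 uv; rewrite lef_pV2 ?posrE ?powR_gt0//; last exact: lt_le_trans uv.
    by apply: ge0_ler_powR => //; rewrite nnegrE; lra.
  have lower : ((t + 1) `^ l)^-1 * m <= b `^ l.
    rewrite -int_eq -cst_int; apply: le_Rintegral => //.
    by move=> x; rewrite /D /= in_itv/= => /andP[x0 x1]; apply: le_pow; lra.
  have upper : b `^ l <= ((t - 1) `^ l)^-1 * m.
    rewrite -int_eq -cst_int; apply: le_Rintegral => //.
    by move=> x; rewrite /D /= in_itv/= => /andP[x0 x1]; apply: le_pow; lra.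
  have tp : 0 < t + 1 by lra.
  have tm : 0 < t - 1 by lra.
  have bp : b * (t + 1) = t / (t - 1) by rewrite /b; field; rewrite !gt_eqF.
  have bm : t / (t + 1) = b * (t - 1) by rewrite /b; field; rewrite !gt_eqF.
  apply/andP; split; last first.
    rewrite /q -bp (powRM _ (ltW b0) (ltW tp)) -ler_pdivrMr ?powR_gt0// mulrC; exact: lower.
  apply: (@le_trans _ _ ((b * (t - 1)) `^ l)); last first.
    by rewrite (powRM _ (ltW b0) (ltW tm)) -ler_pdivlMr ?powR_gt0// mulrC.
  have X0 : 0 <= t / (t - 1) by rewrite divr_ge0//; lra.
  have -> : (q t)^-1 = (t / (t - 1))^-1 `^ l.
    by rewrite -(powR_inv1 X0) -powRrM mulN1r powRN.
  apply: ge0_ler_powR => //.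
  - by rewrite nnegrE invr_ge0.
  - by rewrite nnegrE mulr_ge0// ltW.
  - by rewrite -bm invf_div ler_pdivrMr ?(lt_trans ltr01 t1)// mulrAC ler_pdivlMr//; nra.
have q1 : (fun n => q (n%:R + 2)) @ \oo --> (1 : R).
  have -> : (fun n => q (n%:R + 2)) = (fun x => x `^ l) \o (fun n => 1 + harmonic n).
    apply/funext => n; rewrite /q /=; congr (_ `^ _); rewrite -natr1; field.
    by rewrite nat1r pnatr_eq0.
  have h_cvg : (fun n => 1 + harmonic n) @ \oo --> (1 + 0 : R).
    exact: (cvgD (cvg_cst _) cvg_harmonic).
  have c1 : {for (1 + 0 : R), continuous (fun x : R => x `^ l)}.
    by rewrite addr0; exact: (derive_continuous (is_derive1_powR l ltr01)).
  have := continuous_cvg _ c1 h_cvg; rewrite addr0 powR1; exact.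
have t1 n : 1 < n%:R + 2 :> R by have := ler0n R n; lra.
have qV1 : (fun n => (q (n%:R + 2))^-1) @ \oo --> (1 : R).
  have := cvgV (oner_neq0 R) q1; rewrite invr1.
  exact.
apply/eqP; rewrite eq_le; apply/andP; split.
- rewrite -(cvg_lim _ q1)//; apply: limr_ge; first by apply/cvg_ex; exists 1.
  by apply: nearW => n; case/andP : (bounds _ (t1 n)).
- rewrite -(cvg_lim _ qV1)//; apply: limr_le; first by apply/cvg_ex; exists 1.
  by apply: nearW => n; case/andP : (bounds _ (t1 n)).
Qed.

End conclusion.

Theorem proposition4p1 (R : realType) (l : R) (l1 : 1 <= l) :
  mu_l l1 [set: R]%classic = 1%E /\
  forall z : R[i], stieltjes_domain (mu_l l1) z ->
    stieltjes l (mu_l l1) z = Cpow (stieltjes 1 sym_bernoulli z) l.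
Proof.
split; first exact: mu_l_mass.
by move=> z /(_ 1 (support_mu_l l1)); rewrite rmorph1; exact: stieltjes_mu_l.
Qed.
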